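(* For all integers $i,j\ge0$, the sequence $([DH_n]_{(i,j)})_n$ of $(i,j)$-bigraded components of the diagonal harmonics is URS with URS stable range $n\ge2(i+j)$.
   Context: $S_n$ acts diagonally on $\mathbb{C}[x_1,\dots,x_n,y_1,\dots,y_n]$ by $\sigma\cdot x_k=x_{\sigma(k)}$, $\sigma\cdot y_k=y_{\sigma(k)}$. The diagonal harmonics are the bigraded $S_n$-submodule $$DH_n=\Bigl\{f : \sum_{k=1}^n\Bigl(\tfrac{\partial}{\partial x_k}\Bigr)^a\Bigl(\tfrac{\partial}{\partial y_k}\Bigr)^b f=0\ \text{ for all }(a,b)\in\mathbb{N}^2\setminus\{(0,0)\}\Bigr\},$$ and $[DH_n]_{(i,j)}$ is its component of degree $i$ in the $x$'s and $j$ in the $y$'s. The connective maps are the restrictions $DH_n\to DH_{n+1}$ of the standard inclusion $\mathbb{C}[x_1,\dots,x_n,y_1,\dots,y_n]\to\mathbb{C}[x_1,\dots,x_{n+1},y_1,\dots,y_{n+1}]$, $x_k\mapsto x_k$, $y_k\mapsto y_k$. For a partition $\lambda$ and $n\ge|\lambda|+\lambda_1$, $\lambda[n]:=(n-|\lambda|,\lambda_1,\lambda_2,\dots)\vdash n$, and $\mathbb{S}^\nu$ denotes the Specht module. A sequence of $\mathbb{C}[S_n]$-modules $V_n\cong\bigoplus_\lambda(\mathbb{S}^{\lambda[n]})^{\oplus c_{\lambda,n}}$ ($c_{\lambda,n}=0$ if $\lambda[n]$ is undefined) with $S_n$-equivariant maps $\phi_n:V_n\to V_{n+1}$ satisfying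 $(n+1\ \ n+2)\cdot\phi_{n+1}\circ\phi_n=\phi_{n+1}\circ\phi_n$ is URS (uniformly representation stable) with URS stable range $n\ge N$ if for all $n\ge N$: $c_{\lambda,n}=c_{\lambda,n+1}$ for all $\lambda$, $\phi_n$ is injective, and the $S_{n+1}$-submodule generated by $\phi_n(V_n)$ is $V_{n+1}$. *)

(* Defs.v *)
(* Mathematical Components, with the multinomials library for polynomials. *)
From HB Require Import structures.
From mathcomp Require Import all_boot all_order all_algebra all_fingroup.
From mathcomp Require Import mxrepresentation character mpoly.
From mathcomp Require Import boolp classical_sets reals complex.

Set Implicit Arguments.
Unset Strict Implicit.
Unset Printing Implicit Defensive.

Import GRing.Theory.
Local Open Scope ring_scope.

Section VariableRenaming.

Variables (F : fieldType).

Definition rename N M (g : 'I_N -> 'I_M) (p : {mpoly F[N]}) : {mpoly F[M]} :=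
  p \mPo [tuple 'X_(g k) | k < N].

HB.instance Definition _ N M (g : 'I_N -> 'I_M) :=
  GRing.Linear.copy (@rename N M g)
    (comp_mpoly [tuple 'X_(g k) | k < N] : {mpoly F[N]} -> {mpoly F[M]}).

Lemma renameXU N M (g : 'I_N -> 'I_M) k : rename g 'X_k = 'X_(g k).
Proof. by rewrite /rename comp_mpolyXU -tnth_nth tnth_mktuple. Qed.

Lemma renameM N M (g : 'I_N -> 'I_M) : {morph rename g : p q / p * q}.
Proof. by move=> p q; rewrite /rename rmorphM. Qed.

Lemma rename1 N M (g : 'I_N -> 'I_M) : rename g 1 = 1.
Proof. by rewrite /rename rmorph1. Qed.

Lemma linear_mpoly_eq N M (D E : {linear {mpoly F[N]} -> {mpoly F[M]}}) :
  (forall m, D 'X_[m] = E 'X_[m]) -> D =1 E.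
Proof.
move=> DE p; rewrite [p]mpolyE !raddf_sum /=.
by apply: eq_bigr => m _; rewrite !linearZ DE.
Qed.

Lemma mnm_ind N (P : 'X_{1..N} -> Prop) :
  P 0%MM -> (forall k m, P m -> P (U_(k) + m)%MM) -> forall m, P m.
Proof.
move=> P0 PS m; have [d] := ubnP (mdeg m); elim: d m => // d IHd m.
have [->|nz] := eqVneq m 0%MM; first by [].
have /existsP[k nzk]: [exists k, m k != 0%N].
  apply: contraT; rewrite negb_exists => /forallP h.
  by case/eqP: nz; apply/mnmP => k; rewrite mnm0E; apply/eqP; move/negbNE: (h k).
have le: (U_(k) <= m)%MM by rewrite lep1mP.
have -> : m = (U_(k) + (m - U_(k)))%MM by rewrite addmC submK.
rewrite mdegD mdeg1 add1n ltnS => lt; apply: PS; exact: IHd.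
Qed.

Lemma rename_id N : rename (@id 'I_N) =1 id.
Proof.
move=> p; rewrite /rename -[RHS]comp_mpoly_id; congr (_ \mPo _).
Qed.

Lemma eq_rename N M (g h : 'I_N -> 'I_M) : g =1 h -> rename g =1 rename h.
Proof.
move=> gh p; rewrite /rename; congr (_ \mPo _).
by apply: eq_from_tnth => k; rewrite !tnth_mktuple gh.
Qed.

Lemma rename_comp N M L (h : 'I_M -> 'I_L) (g : 'I_N -> 'I_M) p :
  rename (h \o g) p = rename h (rename g p).
Proof.
apply: (@linear_mpoly_eq _ _ (rename (h \o g)) (rename h \o rename g)) => m /=.
elim/mnm_ind: m => [|k m IH]; first by rewrite mpolyX0 !rename1.
by rewrite mpolyXD !renameM IH !renameXU.
Qed.

Lemma renameX N M (g : 'I_N -> 'I_M) m :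
  rename g 'X_[m] = 'X_[\sum_k U_(g k) *+ m k].
Proof.
elim/mnm_ind: m => [|k m IH].
  rewrite mpolyX0 rename1 big1 ?mpolyX0 // => k _.
  by apply/mnmP => l; rewrite mulmnE !mnm0E muln0.
rewrite mpolyXD renameM renameXU IH -mpolyXD; congr 'X_[_].
apply/mnmP => l; rewrite mnmDE !mnm_sumE (bigD1 k) //= [RHS](bigD1 k) //=.
rewrite addnA; congr (_ + _)%N; last first.
  apply: eq_bigr => i ik; congr (fun_of_multinom (_ *+ _)%MM _).
  by rewrite mnmDE mnm1E eq_sym (negbTE ik).
by rewrite !mulmnE mnmDE (mnm1E k k) eqxx mulnDr muln1.
Qed.

Lemma mderiv_rename N M (g : 'I_N -> 'I_M) k p : injective g ->
  (rename g p)^`M(g k) = rename g p^`M(k).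
Proof.
move=> g_inj.
have submm L (m : 'X_{1..L}) : (m - m)%MM = 0%MM.
  by apply/mnmP => l; rewrite mnmBE subnn mnm0E.
apply: (@linear_mpoly_eq _ _ (mderiv (g k) \o rename g)
                             (rename g \o mderiv k)) => m /=.
elim/mnm_ind: m => [|l m IH]; first by rewrite mpolyX0 rename1 -!mpolyC1 !mderivC linear0.
rewrite mpolyXD renameM !mderivM linearD /= !renameM IH !renameXU; congr (_ * _ + _).
rewrite !mderivX !mnm1E linearZ /= (inj_eq g_inj); case: eqP => [->|_].
  by rewrite !scale1r !submm !mpolyX0 rename1.
by rewrite !scale0r.
Qed.

Lemma mderiv_rename0 N M (g : 'I_N -> 'I_M) l p : (forall k, g k != l) ->
  (rename g p)^`M(l) = 0.
Proof.
move=> gl; apply: (@linear_mpoly_eq _ _ (mderiv l \o rename g) \0) => m /=.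
elim/mnm_ind: m => [|k m IH]; first by rewrite mpolyX0 rename1 -mpolyC1 mderivC.
rewrite mpolyXD renameM mderivM IH renameXU mulr0 addr0.
by rewrite mderivX mnm1E (negbTE (gl k)) scale0r mul0r.
Qed.

Lemma mderivn_rename N M (g : 'I_N -> 'I_M) k a p : injective g ->
  (rename g p)^`M(g k, a) = rename g p^`M(k, a).
Proof.
by move=> ?; elim: a => [|a IH]; rewrite ?mderivn0 // !mderivnS IH mderiv_rename.
Qed.

Lemma mderivn_rename0 N M (g : 'I_N -> 'I_M) l a p : (0 < a)%N ->
  (forall k, g k != l) -> (rename g p)^`M(l, a) = 0.
Proof.
case: a => // a _ gl; elim: a => [|a IH]; last by rewrite mderivnS IH linear0.
by rewrite mderivnS mderivn0 mderiv_rename0.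
Qed.

End VariableRenaming.

Section DiagonalHarmonics.

Variable F : fieldType.

(* In {mpoly F[n + n]}, the variable x_k is 'X_(lshift n k) and the variable  *)
(* y_k is 'X_(rshift n k).                                                    *)
Definition diag_index n m (f : 'I_n -> 'I_m) (k : 'I_(n + n)) : 'I_(m + m) :=
  match split k with
  | inl a => lshift m (f a)
  | inr b => rshift m (f b)
  end.

(* The substitution x_k |-> x_(f k), y_k |-> y_(f k): the diagonal action for *)
(* f a permutation, the standard inclusion for f the inclusion of index sets. *)
Definition diag_subst n m (f : 'I_n -> 'I_m) :
    {mpoly F[n + n]} -> {mpoly F[m + m]} :=
  rename (diag_index f).

HB.instance Definition _ n m (f : 'I_n -> 'I_m) :=
  GRing.Linear.copy (diag_subst f) (@rename F _ _ (diag_index f)).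

Definition polarized_power_sum_diff n (a b : nat) (p : {mpoly F[n + n]}) :
    {mpoly F[n + n]} :=
  \sum_(k < n) (p^`M(rshift n k, b))^`M(lshift n k, a).

Definition diag_harmonic n : {pred {mpoly F[n + n]}} :=
  fun p => `[< forall a b : nat, (a, b) != (0, 0)%N ->
                 polarized_power_sum_diff a b p = 0 >].

Definition bihomog n (i j : nat) : {pred {mpoly F[n + n]}} :=
  fun p => all [pred m : 'X_{1..n + n} |
                  (\sum_(k < n) m (lshift n k) == i)%N
                  && (\sum_(k < n) m (rshift n k) == j)%N] (msupp p).

Definition bigraded_DH n (i j : nat) : {pred {mpoly F[n + n]}} :=
  [predI diag_harmonic (n := n) & bihomog (n := n) i j].

Lemma diag_harmonicP n (p : {mpoly F[n + n]}) :
  reflect (forall a b : nat, (a, b) != (0, 0)%N ->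
             polarized_power_sum_diff a b p = 0)
          (p \in @diag_harmonic n).
Proof. exact: asboolP. Qed.

Lemma polarized_power_sum_diff_is_linear n a b :
  linear (@polarized_power_sum_diff n a b).
Proof.
move=> c p q; rewrite /polarized_power_sum_diff scaler_sumr -big_split /=.
by apply: eq_bigr => k _; rewrite !linearP.
Qed.

HB.instance Definition _ n a b :=
  GRing.isLinear.Build F {mpoly F[n + n]} {mpoly F[n + n]} _
    (@polarized_power_sum_diff n a b) (polarized_power_sum_diff_is_linear a b).

Lemma bihomog_submod_closed n i j : submod_closed (@bihomog n i j).
Proof.
split=> [|c p q /allP hp /allP hq]; first by rewrite unfold_in /bihomog msupp0.
apply/allP => m /msuppD_le; rewrite mem_cat => /orP[/msuppZ_le|]; [exact: hp | exact: hq].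
Qed.

Lemma bigraded_DH_submod_closed n i j : submod_closed (@bigraded_DH n i j).
Proof.
have [h0 hD] := bihomog_submod_closed n i j.
split=> [|c p q]; rewrite !inE.
  by rewrite h0 andbT; apply/diag_harmonicP => a b _; rewrite linear0.
case/andP=> /diag_harmonicP hp bp /andP[/diag_harmonicP hq bq].
apply/andP; split; last exact: hD.
by apply/diag_harmonicP => a b ab; rewrite linearP /= hp // hq // scaler0 addr0.
Qed.

HB.instance Definition _ n i j :=
  GRing.isSubmodClosed.Build F {mpoly F[n + n]} (@bigraded_DH n i j)
    (@bigraded_DH_submod_closed n i j).

Record DH n i j := DHComp {
  DH_val :> {mpoly F[n + n]};
  DH_valP : DH_val \in @bigraded_DH n i j
}.

HB.instance Definition _ n i j := [isSub for @DH_val n i j].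
HB.instance Definition _ n i j := [Choice of DH n i j by <:].
HB.instance Definition _ n i j :=
  [SubChoice_isSubLmodule of DH n i j by <:].

Lemma diag_index_lshift n m (f : 'I_n -> 'I_m) k :
  diag_index f (lshift n k) = lshift m (f k).
Proof. by rewrite /diag_index (unsplitK (inl k)). Qed.

Lemma diag_index_rshift n m (f : 'I_n -> 'I_m) k :
  diag_index f (rshift n k) = rshift m (f k).
Proof. by rewrite /diag_index (unsplitK (inr k)). Qed.

Lemma diag_index_inj n m (f : 'I_n -> 'I_m) :
  injective f -> injective (diag_index f).
Proof.
move=> f_inj k l; rewrite -[k]splitK -[l]splitK.
case: (split k) => a; case: (split l) => b /=;
  rewrite ?diag_index_lshift ?diag_index_rshift.
- by move/lshift_inj/f_inj->.
- by move/eqP; rewrite eq_lrshift.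
- by move/eqP; rewrite eq_rlshift.
- by move/rshift_inj/f_inj->.
Qed.

Lemma eq_diag_subst n m (f g : 'I_n -> 'I_m) :
  f =1 g -> diag_subst f =1 diag_subst g.
Proof.
by move=> fg; apply: eq_rename => k; rewrite /diag_index; case: split => a;
  rewrite fg.
Qed.

Lemma diag_subst_id n (f : 'I_n -> 'I_n) : f =1 id -> diag_subst f =1 id.
Proof.
move=> f1 p; rewrite (eq_diag_subst f1) /diag_subst -[RHS]rename_id.
apply: eq_rename => k /=; rewrite -[RHS]splitK /diag_index.
by case: split.
Qed.

Lemma diag_subst_comp n m l (g : 'I_m -> 'I_l) (f : 'I_n -> 'I_m) p :
  diag_subst (g \o f) p = diag_subst g (diag_subst f p).
Proof.
rewrite /diag_subst -rename_comp; apply: eq_rename => k /=.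
rewrite {1 3}/diag_index; case: split => a.
  by rewrite diag_index_lshift.
by rewrite diag_index_rshift.
Qed.

Lemma bihomog_diag_subst n m (f : 'I_n -> 'I_m) i j p :
  p \in @bihomog n i j -> diag_subst f p \in @bihomog m i j.
Proof.
have [h0 hD] := bihomog_submod_closed m i j.
have sum1 l (h : 'I_l -> nat) (k0 : 'I_l) :
    (\sum_(k < l) (k0 == k) * h k)%N = h k0.
  rewrite (bigD1 k0) //= eqxx mul1n big1 ?addn0 // => k.
  by rewrite eq_sym => /negbTE->.
move=> /allP hp; rewrite /diag_subst [p]mpolyE raddf_sum /=.
rewrite big_seq; elim/big_rec: _ => // mo q mo_p hq.
rewrite linearZ /=; apply: hD => //; rewrite renameX.
apply/allP => mo'; rewrite msuppX mem_seq1 => /eqP -> /=.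
have /= /andP[/eqP <- /eqP <-] := hp _ mo_p.
apply/andP; split; apply/eqP.
- under eq_bigr do rewrite mnm_sumE.
  rewrite exchange_big big_split_ord /= [X in (_ + X)%N]big1 ?addn0 => [|k _].
    apply: eq_bigr => k _; rewrite diag_index_lshift.
    under eq_bigr do rewrite mulmnE mnm1E eq_lshift.
    by rewrite (sum1 _ (fun=> mo (lshift n k))).
  by rewrite big1 // => l _; rewrite diag_index_rshift mulmnE mnm1E eq_rlshift.
- under eq_bigr do rewrite mnm_sumE.
  rewrite exchange_big big_split_ord /= [X in (X + _)%N]big1 ?add0n => [|k _].
    apply: eq_bigr => k _; rewrite diag_index_rshift.
    under eq_bigr do rewrite mulmnE mnm1E eq_rshift.
    by rewrite (sum1 _ (fun=> mo (rshift n k))).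
  by rewrite big1 // => l _; rewrite diag_index_lshift mulmnE mnm1E eq_lrshift.
Qed.

Lemma polarized_power_sum_diff_subst n m (f : 'I_n -> 'I_m) a b p :
  injective f -> (a, b) != (0, 0)%N ->
  polarized_power_sum_diff a b (diag_subst f p) =
  diag_subst f (polarized_power_sum_diff a b p).
Proof.
move=> f_inj ab; have g_inj := diag_index_inj f_inj.
rewrite /polarized_power_sum_diff raddf_sum /= (bigID (mem (codom f))) /=.
rewrite [X in _ + X]big1 ?addr0 => [|l /codomP nl].
  rewrite -[LHS]big_filter (perm_big (map f (enum 'I_n))) /=.
    rewrite big_map big_enum /=; apply: eq_bigr => k _.
    by rewrite -diag_index_lshift -diag_index_rshift !mderivn_rename.
  apply: uniq_perm; rewrite ?filter_uniq ?index_enum_uniq //.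
    by rewrite map_inj_uniq ?enum_uniq.
  by move=> l; rewrite mem_filter mem_index_enum andbT.
have off s : (s = lshift m l \/ s = rshift m l) -> forall k, diag_index f k != s.
  move=> sE k; apply/eqP; rewrite /diag_index => E; apply: nl.
  case: (split k) E sE => c <- [] /eqP.
  - by rewrite eq_lshift => /eqP <-; exists c.
  - by rewrite eq_lrshift.
  - by rewrite eq_rlshift.
  - by rewrite eq_rshift => /eqP <-; exists c.
case: (posnP b) ab => [->|b_gt0 _].
  rewrite mderivn0; case: (posnP a) => [-> //|a_gt0 _].
  by rewrite mderivn_rename0 //; apply: off; left.
rewrite mderivn_rename0 ?linear0 //; last by apply: off; right.
Qed.

Lemma bigraded_DH_diag_subst n m (f : 'I_n -> 'I_m) i j p : injective f ->
  p \in @bigraded_DH n i j -> diag_subst f p \in @bigraded_DH m i j.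
Proof.
move=> f_inj; rewrite !inE => /andP[/diag_harmonicP hp bp].
rewrite bihomog_diag_subst // andbT; apply/diag_harmonicP => a b ab.
by rewrite polarized_power_sum_diff_subst // hp // linear0.
Qed.

Definition DH_subst n m (f : 'I_n -> 'I_m) (f_inj : injective f) i j
    (p : DH n i j) : DH m i j :=
  DHComp (bigraded_DH_diag_subst f_inj (DH_valP p)).

Lemma DH_subst_is_linear n m (f : 'I_n -> 'I_m) (f_inj : injective f) i j :
  linear (@DH_subst n m f f_inj i j).
Proof. by move=> c p q; apply: val_inj => /=; rewrite linearP. Qed.

HB.instance Definition _ n m (f : 'I_n -> 'I_m) (f_inj : injective f) i j :=
  GRing.isLinear.Build F (DH n i j) (DH m i j) _ (@DH_subst n m f f_inj i j)
    (@DH_subst_is_linear n m f f_inj i j).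

End DiagonalHarmonics.

(* An F[S_n]-module. In {perm _}, (s * t) k = t (s k), so that an {action _}  *)
(* v, s |-> s . v, for which (s * t) . v = t . (s . v), is a left action for  *)
(* the composition of permutations.                                           *)
Record snModule (F : fieldType) n := SnModule {
  sn_carrier :> lmodType F;
  sn_act : {action 'S_n &-> sn_carrier};
  sn_act_linear : forall s, linear (sn_act^~ s)
}.

Section DHModule.

Variables (F : fieldType) (n i j : nat).

Definition DH_act (p : DH F n i j) (s : 'S_n) : DH F n i j :=
  DH_subst (@perm_inj _ s) p.

Lemma DH_act1 : DH_act^~ 1%g =1 id.
Proof.
move=> p; apply: val_inj => /=; apply: diag_subst_id => k.
by rewrite perm1.
Qed.

Lemma DH_actM p : act_morph DH_act p.
Proof.
move=> s t; apply: val_inj => /=; rewrite -diag_subst_comp.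
by apply: eq_diag_subst => k; rewrite permM.
Qed.

Definition DH_module : snModule F n :=
  @SnModule F n (DH F n i j) (TotalAction DH_act1 DH_actM)
    (fun s => @DH_subst_is_linear F n n s (@perm_inj _ s) i j).

End DHModule.

(* lift ord_max : 'I_n -> 'I_n.+1 preserves the value of the index. *)
Definition DH_incl (F : fieldType) (i j n : nat) :
    {linear DH_module F n i j -> DH_module F n.+1 i j} :=
  @DH_subst F n n.+1 (lift ord_max) (@lift_inj _ ord_max) i j.

Section SpechtModules.

Variables (F : fieldType) (n : nat).

Section PermutationRepresentation.

Variables (gT : finGroupType) (T : finType) (to : {action gT &-> T}).

Definition perm_repr_mx (g : gT) : 'M[F]_#|T| :=
  \matrix_(a < #|T|) delta_mx 0 (enum_rank (to (enum_val a) g)).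

Lemma perm_repr_mx_repr : mx_repr [set: gT] perm_repr_mx.
Proof.
split=> [|g h _ _]; apply/row_matrixP => a; rewrite rowK.
  by rewrite act1 enum_valK row1.
by rewrite row_mul rowK -rowE rowK enum_rankK actM.
Qed.

Definition perm_repr := MxRepresentation perm_repr_mx_repr.

End PermutationRepresentation.

(* A tabloid is encoded by the function that maps each entry to its row. The  *)
(* values in 'I_n suffice, since a partition of n has at most n rows.         *)
Definition tabloid := {ffun 'I_n -> 'I_n}.

Definition tabloid_act (r : tabloid) (s : 'S_n) : tabloid :=
  [ffun k => r (s^-1%g k)].

Lemma tabloid_act1 : tabloid_act^~ 1%g =1 id.
Proof. by move=> r; apply/ffunP => k; rewrite ffunE invg1 perm1. Qed.

Lemma tabloid_actM r : act_morph tabloid_act r.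
Proof. by move=> s t; apply/ffunP => k; rewrite !ffunE invMg permM. Qed.

Definition tabloid_action := TotalAction tabloid_act1 tabloid_actM.

(* The direct sum of the permutation modules on the tabloids of all shapes.   *)
Definition tabloid_repr := perm_repr tabloid_action.

Definition tabloid_vec (r : tabloid) : 'rV[F]_#|{: tabloid}| :=
  delta_mx 0 (enum_rank r).

(* A tableau is encoded by the function that maps each entry to the pair of   *)
(* the row and the column of its cell.                                        *)
Definition tableau := {ffun 'I_n -> 'I_n * 'I_n}.

(* For nu a partition of n, possibly followed by zeros, these are the         *)
(* bijective fillings of the diagram of nu.                                   *)
Definition is_tableau (nu : seq nat) (T : tableau) : bool :=
  injectiveb T &&
  [forall cell, (cell \in codom T) == (cell.2 < nth 0 nu cell.1)%N].

Definition rows (T : tableau) : tabloid := [ffun k => (T k).1].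

Definition column_stabilizer (T : tableau) : pred 'S_n :=
  fun s => [forall k, (T (s k)).2 == (T k).2].

Definition polytabloid (T : tableau) : 'rV[F]_#|{: tabloid}| :=
  \sum_(s : 'S_n | column_stabilizer T s)
     (-1) ^+ s *: tabloid_vec (tabloid_act (rows T) s).

Definition specht_mx (nu : seq nat) : 'M[F]_#|{: tabloid}| :=
  (\sum_(T : tableau | is_tableau nu T)
      cyclic_mx tabloid_repr (polytabloid T))%MS.

Lemma specht_mx_module nu : mxmodule tabloid_repr (specht_mx nu).
Proof. by apply: sumsmx_module => T _; apply: cyclic_mx_module. Qed.

Definition specht (nu : seq nat) : representation F [set: 'S_n] :=
  Representation (submod_repr (specht_mx_module nu)).

End SpechtModules.

Section UniformRepresentationStability.

Variable F : fieldType.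

Definition is_partition (la : seq nat) : bool :=
  sorted geq la && (0%N \notin la).

Definition padded_defined (n : nat) (la : seq nat) : bool :=
  is_partition la && (sumn la + head 0 la <= n)%N.

(* For la = [::] and n = 0 this is [:: 0], the empty partition. *)
Definition padded (n : nat) (la : seq nat) : seq nat :=
  (n - sumn la)%N :: la.

(* If la[n] is defined, then la has at most n parts, each of them at most n,  *)
(* so that la is exactly one of the bounded sequences below.                  *)
Definition specht_sum n (c : seq nat -> nat) : representation F [set: 'S_n] :=
  \big[dadd_grepr/grepr0]_(la : n.-bseq 'I_n.+1
                             | padded_defined n (map val la))
     muln_grepr (specht F n (padded n (map val la))) (c (map val la)).

(* The row vectors are acted upon by right multiplication, in accordance with *)
(* the convention of sn_act.                                                  *)
Definition sn_iso n (V : snModule F n) (W : representation F [set: 'S_n]) :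
    Prop :=
  exists2 f : {linear 'rV[F]_(rdegree W) -> V}, bijective f &
    forall v (s : 'S_n), f (v *m W s) = sn_act V (f v) s.

Definition is_submodule n (V : snModule F n) (U : set V) : Prop :=
  [/\ U 0,
      forall (a : F) u v, U u -> U v -> U (a *: u + v)
    & forall u (s : 'S_n), U u -> U (sn_act V u s)].

Variables (V : forall n, snModule F n).
Variable phi : forall n, {linear V n -> V n.+1}.

(* S_n is embedded in S_n.+1 as the stabilizer of the last point. *)
Definition sn_equivariant : Prop := forall n (v : V n) (s : 'S_n),
  phi n (sn_act (V n) v s) =
  sn_act (V n.+1) (phi n v) (lift_perm ord_max ord_max s).

Definition last_transposition n : 'S_n.+2 := tperm (inord n) ord_max.

Definition fixed_by_last_transposition : Prop := forall n (v : V n),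
  sn_act (V n.+2) (phi n.+1 (phi n v)) (last_transposition n) =
  phi n.+1 (phi n v).

Definition URS (N : nat) : Prop :=
  [/\ sn_equivariant, fixed_by_last_transposition &
  exists c : nat -> seq nat -> nat,
    [/\ forall n la, ~~ padded_defined n la -> c n la = 0%N,
        forall n, sn_iso (V n) (specht_sum n (c n))
      & forall n, (N <= n)%N ->
          [/\ forall la, c n la = c n.+1 la,
              injective (phi n)
            & smallest (@is_submodule n.+1 (V n.+1)) (range (phi n))
                = classical_sets.setT]]].

End UniformRepresentationStability.

(* Main.v *)
Require Import Defs.
From HB Require Import structures.
From mathcomp Require Import all_boot all_order all_algebra all_fingroup.
From mathcomp Require Import pgroup mxrepresentation character mpoly.

(** The multiplicity of the Specht module of shape nu in an S_n-module V is the
    rank on V of the Young symmetrizer of any tableau T of shape nu, which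
    antisymmetrizes over the columns of T and then symmetrizes over its rows.
    This rank is 1 on the Specht module of T and 0 on the others
    ([rank_young_specht]), by James's argument: a tabloid survives the column
    antisymmetrizer of T only if no two entries of one of its rows share a
    column of T, so that its shape is dominated by that of T, with equality
    only for the column permutations of the tabloid of T.  Hence the Specht
    modules are irreducible and pairwise non-isomorphic; as permutations of the
    same cycle type are conjugate ([card_classes_perm]), there are enough of
    them to exhaust the irreducible representations, and every
    finite-dimensional S_n-module is a sum of them ([specht_decomposition]).

    For the stability, let d = i + j, let n >= 2d, and let T be a tableau of
    shape la[n].  If |la| > d, then T has fewer than n - d columns, while a
    monomial of degree d involves at most d indices: two absent indices share a
    column and the antisymmetrizer kills the monomial ([col_sum_weight]).  So
    only the la with |la| <= d occur, and for them la[n] is defined since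
    n >= 2d.  For such la, let T1 be T with n + 1 appended to its first row, and
    send p to the sum over the row permutations of T1 of the images of p in
    n + 1 pairs of variables.  This map
    - is injective on polynomials invariant under the row permutations of T
      ([row_sum_phi_inj]);
    - carries the image of the symmetrizer of T onto the image of the
      symmetrizer of T1, because a monomial that survives the antisymmetrizer of
      T1 omits an index lying in a column of length one, which can be exchanged
      with n + 1 ([young_sum_phi_surj]);
    - commutes with the operators that define the diagonal harmonics.
    By the last two points an element of the image of the symmetrizer of T1 on
    the harmonics comes from a polynomial whose images under those operators
    are sent to 0; by the first point they vanish, so the polynomial is
    harmonic ([DH_young_surj]).  Therefore the multiplicities in degrees n and
    n + 1 agree ([rank_DH_stable]), and the image of each Young symmetrizer on
    the harmonics in n + 1 pairs of variables lies in the submodule generated by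
    the harmonics in n pairs; as no nonzero module is killed by all the
    symmetrizers, that submodule is everything ([DH_generated]). *)

Set Implicit Arguments.
Unset Strict Implicit.
Unset Printing Implicit Defensive.

(** * Conjugacy classes of permutations and partitions *)

Section ConjugacyClasses.

Local Open Scope group_scope.

Variable T : finType.
Implicit Types s t : {perm T}.

Lemma iter_eq_porbit s x a b :
  ((s ^+ a) x == (s ^+ b) x) = (a == b %[mod #|porbit s x|]).
Proof.
have d_gt0 : 0 < #|porbit s x| by rewrite lt0n card_porbit_neq0.
have red c : (s ^+ c) x = nth x (traject s x #|porbit s x|) (c %% #|porbit s x|).
  rewrite nth_traject ?ltn_mod // {1}(divn_eq c #|porbit s x|) addnC expgD permM.
  rewrite -permX; set y := (s ^+ _) x.
  have ey : (s ^+ #|porbit s x|) y = y.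
    by rewrite -(porbit_perm s (c %% #|porbit s x|)) permX iter_porbit.
  elim: (_ %/ _)%N => [|k IHk]; first by rewrite mul0n expg0 perm1.
  by rewrite mulSn expgD permM ey.
rewrite !red nth_uniq ?size_traject ?ltn_mod ?uniq_traject_porbit //.
Qed.

(** The conjugating permutation sends the k-th iterate of the representative
    of an orbit O to the k-th iterate of the representative of F O; since O
    and F O have the same cardinal, it is well defined and injective. *)
Lemma perm_conj_of_porbits s t (F : {set T} -> {set T}) :
    {in porbits s, forall O, F O \in porbits t} ->
    {in porbits s, forall O, #|F O| = #|O|} ->
    {in porbits s &, injective F} ->
  exists g, t = s ^ g.
Proof.
move=> Ft Fcard Finj.
pose rep (O : {set T}) := [pick x in O].
have repP u x : exists2 r, rep (porbit u x) = Some r & porbit u r = porbit u x.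
  rewrite /rep; case: pickP => [r xr|/(_ x)]; last by rewrite porbit_id.
  by exists r => //; apply/eqP; rewrite eq_porbit_mem.
have os x : porbit s x \in porbits s by apply: imset_f.
have reptP x : exists2 r, rep (F (porbit s x)) = Some r
                        & porbit t r = F (porbit s x).
  have /imsetP[y _ ->] := Ft _ (os x); exact: repP.
(* The default values are not taken: see g0E. *)
pose g0 x := odflt x (omap (t ^+ index x
  (oapp (fun r => traject s r #|porbit s x|) [::] (rep (porbit s x))))
  (rep (F (porbit s x)))).
have g0E x : exists r r' k, [/\ rep (porbit s x) = Some r,
   rep (F (porbit s x)) = Some r', porbit s r = porbit s x,
   porbit t r' = F (porbit s x) & x = (s ^+ k) r /\ g0 x = (t ^+ k) r'].
  have [r er orr] := repP s x; have [r' er' or'] := reptP x.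
  exists r, r', (index x (traject s r #|porbit s x|)); split=> //; split; last first.
    by rewrite /g0 er er'.
  have xr : x \in traject s r #|porbit s x|.
    by rewrite -orr -porbit_traject orr porbit_id.
  rewrite permX -(nth_traject s (n := #|porbit s x|)) ?nth_index //.
  by rewrite -[X in _ < X](size_traject s r) index_mem.
have g0_inj : injective g0.
  move=> x y; have [r [r' [k [er er' orr or' [ex ->]]]]] := g0E x.
  have [q [q' [l [dq dq' oq oq' [ey ->]]]]] := g0E y.
  move=> E; rewrite ex ey.
  have : porbit t r' = porbit t q'.
    by rewrite -(porbit_perm t k r') E porbit_perm.
  rewrite or' oq' => /Finj eO; have {}eO := eO (os x) (os y).
  move: dq dq'; rewrite -eO er er' => -[<-] [e']; move: E; rewrite -e'.
  move/eqP; rewrite iter_eq_porbit or' Fcard // -orr -iter_eq_porbit.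
  by move/eqP.
have g0s x : g0 (s x) = t (g0 x).
  have [r [r' [k [er er' orr or' [ex ->]]]]] := g0E x.
  have [q [q' [l [dq dq' oq oq' [ey ->]]]]] := g0E (s x).
  have eO : porbit s (s x) = porbit s x by rewrite -[RHS](porbit_perm s 1) expg1.
  move: dq dq'; rewrite eO er er' => -[e0] [<-].
  rewrite -permM -expgSr; apply/eqP; rewrite iter_eq_porbit or' Fcard // -orr.
  by rewrite -iter_eq_porbit [q in (s ^+ l) q]e0 -ey expgSr permM -ex.
exists (perm g0_inj); apply/permP => x.
rewrite -{1}[x](permKV (perm g0_inj)) /conjg !permM.
by rewrite !permE /= -g0s; congr (g0 (s _)).
Qed.

Definition cycle_type s : seq nat :=
  sort geq [seq #|(X : {set T})| | X <- enum (porbits s)].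

Lemma cycle_type_sorted s : sorted geq (cycle_type s).
Proof. by apply: sort_sorted => a b; apply: leq_total. Qed.

Lemma mem_cycle_type s a : a \in cycle_type s -> 0 < a <= #|T|.
Proof.
rewrite mem_sort => /mapP[O]; rewrite mem_enum => /imsetP[x _ ->] ->.
by rewrite lt0n card_porbit_neq0 max_card.
Qed.

Lemma sumn_cycle_type s : sumn (cycle_type s) = #|T|.
Proof.
rewrite (perm_sumn (permEl (perm_sort _ _))) sumnE big_map big_enum /=.
rewrite -cardsT; have /card_partition -> // : partition (porbits s) [set: T].
have -> : porbits s = orbit 'P <[s]> @: [set: T].
  by apply/setP => X; apply/imsetP/imsetP => -[x _ ->]; exists x;
    rewrite ?porbit.unlock.
by apply: orbit_partition; apply/actsP => u _ x; rewrite !inE.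
Qed.

(** Listing the orbits of s and of t by size matches each orbit with one of
    the same cardinal. *)
Lemma conj_of_cycle_type s t : cycle_type s = cycle_type t ->
  exists g, t = s ^ g.
Proof.
rewrite /cycle_type !sort_map; set ls := sort _ _; set lt := sort _ _ => E.
have sE O : (O \in ls) = (O \in porbits s) by rewrite mem_sort mem_enum.
have tE O : (O \in lt) = (O \in porbits t) by rewrite mem_sort mem_enum.
have size_st : size ls = size lt by have := congr1 size E; rewrite !size_map.
pose F O := nth set0 lt (index O ls).
have idx O : O \in porbits s -> index O ls < size lt.
  by rewrite -sE -size_st index_mem.
apply: (@perm_conj_of_porbits s t F) => [O Os|O Os|O O' Os O's].
- by rewrite -tE mem_nth ?idx.
- have := congr1 (nth 0%N ^~ (index O ls)) E.
  rewrite !(nth_map set0) ?idx ?size_st ?idx // nth_index ?sE //.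
- move/eqP; rewrite nth_uniq ?idx ?sort_uniq ?enum_uniq // => /eqP e.
  by rewrite -[O](nth_index set0 (s := ls)) ?sE // e nth_index // sE.
Qed.

End ConjugacyClasses.

(** The first part is recovered from the others, so that la determines the
    cycle type la[n]. *)
Lemma cycle_typeE n (s : 'S_n) : cycle_type s =
  if n is 0 then [::] else (n - sumn (behead (cycle_type s)))%N :: behead (cycle_type s).
Proof.
have := sumn_cycle_type s; have := @mem_cycle_type _ s; rewrite card_ord.
case: (cycle_type s) => [|a l] mem /= e; first by case: n s mem e.
case: n s mem e => [|n] s mem e; last by rewrite -e addnK.
by have /andP[a_gt0] := mem a (mem_head _ _); rewrite leqNgt a_gt0.
Qed.

Lemma padded_defined_cycle_type n (s : 'S_n) :
  padded_defined n (behead (cycle_type s)).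
Proof.
have := @mem_cycle_type _ s; have := cycle_type_sorted s.
have := sumn_cycle_type s; rewrite card_ord.
case: (cycle_type s) => [|a l] /= e srt mem.
  by rewrite /padded_defined /= -e.
rewrite /padded_defined /is_partition (path_sorted srt) -e addnC leq_add2r /=.
apply/andP; split.
  by apply/negP => l0; have := mem 0%N; rewrite inE l0 orbT => /(_ isT).
by case: l srt {e mem} => //= b l /andP[].
Qed.

Lemma size_padded_defined n la : padded_defined n la -> size la <= n.
Proof.
case/andP=> /andP[_ l0] le; apply: leq_trans (leq_trans (leq_addr _ _) le).
elim: la l0 {le} => //= a l IHl; rewrite inE negb_or => /andP[a0 /IHl].
by rewrite -addn1 addnC; apply: leq_add; rewrite lt0n eq_sym.
Qed.

Lemma mem_padded_defined n la a : padded_defined n la -> a \in la -> a < n.+1.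
Proof.
case/andP=> _ le al; rewrite ltnS.
apply: leq_trans (leq_trans (leq_addr _ _) le).
by rewrite sumnE (big_rem a al) leq_addr.
Qed.

Definition padded_bseq n (la : seq nat) : n.-bseq 'I_n.+1 :=
  insub_bseq n (map inord la).

Lemma padded_bseqK n la : padded_defined n la -> map val (padded_bseq n la) = la.
Proof.
move=> ok; rewrite /padded_bseq /insub_bseq val_insubd size_map size_padded_defined //.
rewrite -map_comp -[RHS]map_id; apply/eq_in_map => a al /=.
by rewrite inordK // (mem_padded_defined ok).
Qed.

(** This is the counting bound behind the completeness of the Specht modules:
    the irreducible representations are as many as the conjugacy classes. *)
Lemma card_classes_perm n :
  #|classes [set: 'S_n]| <=
  #|[pred la : n.-bseq 'I_n.+1 | padded_defined n (map val la)]|.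
Proof.
pose f (C : {set 'S_n}) := padded_bseq n (behead (cycle_type (repr C))).
have fE C : map val (f C) = behead (cycle_type (repr C)).
  exact/padded_bseqK/padded_defined_cycle_type.
have finj : {in classes [set: 'S_n] &, injective f}.
  move=> C D /imsetP[s _ eC] /imsetP[t _ eD] /(congr1 (map val \o val)) /=.
  rewrite -/(map val (f C)) -/(map val (f D)) !fE => e.
  have {e} : cycle_type (repr C) = cycle_type (repr D).
    by rewrite cycle_typeE [RHS]cycle_typeE e.
  case/conj_of_cycle_type => g e.
  have [u _ eu] := repr_class [set: 'S_n] s.
  have [v _ ev] := repr_class [set: 'S_n] t.
  rewrite eC eD -(classGidl s (in_setT u)) -(classGidl t (in_setT v)).
  by rewrite -eu -ev -eC -eD e classGidl ?inE.
rewrite -(card_in_imset finj); apply/subset_leq_card/subsetP => la.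
by case/imsetP=> C _ ->; rewrite inE fE padded_defined_cycle_type.
Qed.

(** * Tableaux and tabloids *)

Section FiberStabilizer.

Variables (n : nat) (X : eqType).
Implicit Type f : 'I_n -> X.

Definition fiber_stab f := [set s : 'S_n | [forall k, f (s k) == f k]].

Lemma fiber_stabP f (s : 'S_n) :
  reflect (forall k, f (s k) = f k) (s \in fiber_stab f).
Proof. by rewrite inE; apply: (iffP forallP) => e k; apply/eqP. Qed.

Lemma fiber_stab_group_set f : group_set (fiber_stab f).
Proof.
apply/group_setP; split=> [|s t /fiber_stabP fs /fiber_stabP ft].
  by apply/fiber_stabP => k; rewrite perm1.
by apply/fiber_stabP => k; rewrite permM ft fs.
Qed.

Canonical fiber_stab_group f := Group (fiber_stab_group_set f).

Lemma tperm_fiber_stab f x y : f x = f y -> tperm x y \in fiber_stab f.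
Proof. by move=> e; apply/fiber_stabP => k; case: tpermP => // ->. Qed.

End FiberStabilizer.

Notation row_group T := (fiber_stab (fun k => (fun_of_fin T k).1)).
Notation col_group T := (fiber_stab (fun k => (fun_of_fin T k).2)).

Section Tableaux.

Variable n : nat.
Implicit Types (T S : tableau n) (r : tabloid n) (nu mu : seq nat).

(** When this fails, some transposition fixes the tabloid r but changes the
    sign of the column antisymmetrizer of T, which therefore kills r. *)
Definition rows_avoid_cols r T :=
  forall x y, r x = r y -> (T x).2 = (T y).2 -> x = y.

Lemma is_tableauP nu T : is_tableau nu T ->
  injective T /\ forall c, (c \in codom T) = (c.2 < nth 0%N nu c.1).
Proof.
by case/andP=> /injectiveP T_inj /forallP h; split=> // c; apply/eqP.
Qed.

Lemma row_col_trivial nu T s : is_tableau nu T ->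
  s \in row_group T -> s \in col_group T -> s = 1%g.
Proof.
case/is_tableauP=> T_inj _ /fiber_stabP rs /fiber_stabP cs.
apply/permP => k; rewrite perm1; apply: T_inj.
by rewrite [LHS]surjective_pairing [RHS]surjective_pairing rs cs.
Qed.

Lemma tableau_perm nu T S : is_tableau nu T -> is_tableau nu S ->
  exists s : 'S_n, forall k, S k = T (s k).
Proof.
case/is_tableauP=> T_inj T_cell /is_tableauP[S_inj S_cell].
have ST k : S k \in codom T by rewrite T_cell -S_cell codom_f.
pose f k := iinv (ST k).
have fE k : T (f k) = S k by apply: f_iinv.
have f_inj : injective f by move=> k l e; apply: S_inj; rewrite -!fE e.
by exists (perm f_inj) => k; rewrite permE fE.
Qed.

Lemma is_tableau_comp nu T (s : 'S_n) : is_tableau nu T ->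
  is_tableau nu [ffun k => T (s k)].
Proof.
case/is_tableauP=> T_inj T_cell; apply/andP; split.
  by apply/injectiveP => k l; rewrite !ffunE => /T_inj/perm_inj.
apply/forallP => c; rewrite -T_cell; apply/eqP; apply/idP/idP => /codomP[k ->].
  by rewrite ffunE codom_f.
by apply/codomP; exists (s^-1%g k); rewrite ffunE permKV.
Qed.

(** If all the entries of the column c of T lie in the rows before k, the
    right-hand side is the size of the column.  Otherwise the column meets
    each of the rows before k, so the right-hand side is k, while the entries
    of the column lie in distinct rows of r. *)
Lemma rows_below_col nu r T c k : sorted geq nu -> is_tableau nu T ->
    rows_avoid_cols r T ->
  #|[pred x | (T x).2 == c & r x < k]| <= #|[pred x | (T x).2 == c & (T x).1 < k]|.
Proof.
move=> nu_sorted /is_tableauP[T_inj T_cell] rT.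
have [all_in|] := boolP [forall x, ((T x).2 == c) ==> ((T x).1 < k)].
  apply: subset_leq_card; apply/subsetP => x; rewrite !inE => /andP[xc _].
  by rewrite xc (implyP (forallP all_in x)).
rewrite negb_forall => /existsP[x]; rewrite negb_imply -leqNgt => /andP[/eqP xc kx].
have kn : k < n by apply: leq_ltn_trans kx (ltn_ord _).
apply: (@leq_trans k).
  set A := [pred x | _].
  have r_inj : {in A &, injective r}.
    by move=> y z /[!inE] /andP[/eqP yc _] /andP[/eqP zc _] /rT; apply; rewrite yc zc.
  rewrite -(card_in_imset r_inj) -[X in _ <= X]card_ord.
  have w_inj : injective (widen_ord (ltnW kn)).
    by move=> i j /(congr1 val) e; apply: val_inj.
  rewrite -(card_imset _ w_inj).
  apply/subset_leq_card/subsetP => _ /imsetP[y /[!inE] /andP[_ yk] ->].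
  by apply/imsetP; exists (Ordinal yk) => //; apply: val_inj.
rewrite -{1}(card_ord k).
have cellP (i : 'I_k) : (widen_ord (ltnW kn) i, c) \in codom T.
  rewrite T_cell /=.
  have : (T x) \in codom T by rewrite codom_f.
  rewrite T_cell xc => /leq_trans; apply.
  have ix : i <= (T x).1 by apply: leq_trans (ltnW (ltn_ord i)) kx.
  have [big|small] := leqP (size nu) (T x).1; first by rewrite nth_default.
  have := @sorted_leq_nth _ geq _ _ 0%N nu nu_sorted; apply=> //.
  - by move=> a b d ba db; apply: leq_trans db ba.
  - by move=> a; apply: leqnn.
  - by rewrite inE (leq_ltn_trans ix).
pose g i := iinv (cellP i).
have gE i : T (g i) = (widen_ord (ltnW kn) i, c) by apply: f_iinv.
have g_inj : injective g.
  by move=> i j e; have := gE i; rewrite e gE => -[/esym e']; apply: val_inj.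
rewrite -(card_imset _ g_inj); apply/subset_leq_card/subsetP => _ /imsetP[i _ ->].
by rewrite !inE gE /= eqxx /=.
Qed.

Lemma rows_below_by_col (f : 'I_n -> 'I_n) T k :
  #|[pred x | f x < k]| = \sum_(c < n) #|[pred x | (T x).2 == c & f x < k]|.
Proof.
rewrite -sum1_card (partition_big (fun x => (T x).2) xpredT) //=.
apply: eq_bigr => c _; rewrite -sum1_card; apply: eq_bigl => x.
by rewrite !inE andbC.
Qed.

(** The shape of r is dominated by that of T, in terms of the sizes of the
    unions of the first rows. *)
Lemma rows_avoid_cols_dominance nu r T k : sorted geq nu -> is_tableau nu T ->
    rows_avoid_cols r T ->
  #|[pred x | r x < k]| <= #|[pred x | (T x).1 < k]|.
Proof.
move=> nu_sorted nuT rT; rewrite (rows_below_by_col r T).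
rewrite (rows_below_by_col (fun x => (T x).1) T).
by apply: leq_sum => c _; exact: (rows_below_col c k nu_sorted nuT rT).
Qed.

(** When the totals agree, the bounds in each column are equalities, so each
    column of T meets the same rows of r as of T.  Hence sending x to its row
    in r and its column in T is a tableau of the same shape, which differs
    from T by a column permutation. *)
Lemma rows_avoid_cols_same_shape nu r T : sorted geq nu -> is_tableau nu T ->
    rows_avoid_cols r T ->
    (forall k, #|[pred x | r x < k]| = #|[pred x | (T x).1 < k]|) ->
  exists2 s, s \in col_group T & r = tabloid_act (rows T) s.
Proof.
move=> nu_sorted nuT rT same.
have same_col c k : #|[pred x | (T x).2 == c & r x < k]|
                  = #|[pred x | (T x).2 == c & (T x).1 < k]|.
  have [_ eq_sum] := @leqif_sum _ xpredT
    (fun c => #|[pred x | (T x).2 == c & r x < k]|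
           == #|[pred x | (T x).2 == c & (T x).1 < k]|) _ _
    (fun c _ => leqif_eq (rows_below_col c k nu_sorted nuT rT)).
  move: eq_sum; rewrite -(rows_below_by_col r T).
  rewrite -(rows_below_by_col (fun x => (T x).1) T) same eqxx.
  by move/esym/forallP/(_ c)/eqP.
have split_card (f : 'I_n -> 'I_n) c (k : 'I_n) :
    #|[pred x | (T x).2 == c & f x < k.+1]|
    = (#|[pred x | (T x).2 == c & f x < k]| + #|[pred x | (T x).2 == c & f x == k]|)%N.
  rewrite -cardUI [X in (_ + X)%N]eq_card0 ?addn0 => [|x]; last first.
    by rewrite !inE; case: eqP => //= _; case: eqP => [->|]; rewrite ?ltnn ?andbF.
  by apply: eq_card => x; rewrite !inE ltnS leq_eqVlt orbC -andb_orr.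
have cell x : (r x, (T x).2) \in codom T.
  have : 0 < #|[pred y | (T y).2 == (T x).2 & (T y).1 == r x]|.
    have := split_card (fun x => (T x).1) (T x).2 (r x).
    rewrite -!same_col (split_card r) => /addnI <-.
    by apply/card_gt0P; exists x; rewrite inE !eqxx.
  case/card_gt0P=> y /[!inE] /andP[/eqP e1 /eqP e2].
  by rewrite -e1 -e2 -surjective_pairing codom_f.
pose q x := iinv (cell x).
have qE x : T (q x) = (r x, (T x).2) by apply: f_iinv.
have q_inj : injective q.
  by move=> x y e; have := qE x; rewrite e qE => -[/esym e1 /esym e2]; apply: rT.
exists (perm q_inj)^-1%g.
  by rewrite groupV; apply/fiber_stabP => k; rewrite permE qE.
by apply/ffunP => x; rewrite !ffunE invgK permE qE.
Qed.

Lemma same_shape_rows nu T S k : is_tableau nu T -> is_tableau nu S ->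
  #|[pred x | (T x).1 < k]| = #|[pred x | (S x).1 < k]|.
Proof.
move=> nuT /(tableau_perm nuT)[s sE].
rewrite -[RHS](card_imset _ (@perm_inj _ s)); apply: eq_card => x.
rewrite !inE; apply/idP/imsetP => [xk|[y + ->]]; last by rewrite inE sE.
by exists (s^-1%g x); rewrite ?inE ?sE permKV.
Qed.

Lemma card_row nu T (i : 'I_n) : is_tableau nu T -> nth 0%N nu i <= n ->
  #|[pred x | (T x).1 == i]| = nth 0%N nu i.
Proof.
case/is_tableauP=> T_inj T_cell le.
rewrite -[RHS](card_ord).
have cellP (c : 'I_(nth 0%N nu i)) : (i, widen_ord le c) \in codom T.
  by rewrite T_cell /=.
pose g c := iinv (cellP c).
have gE c : T (g c) = (i, widen_ord le c) by apply: f_iinv.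
have g_inj : injective g.
  by move=> c d e; have := gE c; rewrite e gE => -[/esym e']; apply: val_inj.
rewrite -(card_imset _ g_inj); apply: eq_card => x.
rewrite inE; apply/eqP/imsetP => [xi|[c _ ->]]; last by rewrite gE.
have : T x \in codom T by rewrite codom_f.
rewrite T_cell xi => lt; exists (Ordinal lt) => //; apply: T_inj.
rewrite gE [LHS]surjective_pairing xi; congr (_, _); exact: val_inj.
Qed.

End Tableaux.

Lemma sorted_padded n la : padded_defined n la -> sorted geq (padded n la).
Proof.
case/andP=> /andP[srt _] le; rewrite /padded /=.
case: la srt le => //= a l srt le; rewrite srt andbT.
by rewrite /= leq_subRL // (leq_trans (leq_addr _ _) le).
Qed.

Lemma size_padded n la : padded_defined n la -> 0 < n -> size (padded n la) <= n.
Proof.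
case/andP=> /andP[_ l0] le n_gt0; rewrite /=.
case: la l0 le => [|a l] //=; rewrite inE negb_or eq_sym -lt0n => /andP[a_gt0 l0] le.
apply: leq_trans le; rewrite -addn1 -add1n !leq_add //.
elim: l l0 => //= b l IHl; rewrite inE negb_or eq_sym -lt0n => /andP[b0 /IHl le].
by rewrite -add1n leq_add.
Qed.

Lemma nth_padded_le n la i : padded_defined n la -> nth 0%N (padded n la) i <= n.
Proof.
case: i => [|i] ok /=; first exact: leq_subr.
have [lt|ge] := ltnP i (size la); last by rewrite nth_default.
by rewrite -ltnS (mem_padded_defined ok) ?mem_nth.
Qed.

Lemma padded_inj n la mu : padded_defined n la -> padded_defined n mu ->
  (forall i, i < n -> nth 0%N (padded n la) i = nth 0%N (padded n mu) i) ->
  la = mu.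
Proof.
case: (posnP n) => [n0 lam mum _|n_gt0 lam mum e].
  have := size_padded_defined lam; have := size_padded_defined mum.
  by rewrite n0 !leqn0 => /nilP-> /nilP->.
have {}e i : nth 0%N la i = nth 0%N mu i.
  have [/e //|ge] := ltnP i.+1 n.
  have big nu : padded_defined n nu -> nth 0%N nu i = 0%N.
    move=> ok; rewrite nth_default // -ltnS.
    exact: leq_trans (size_padded ok n_gt0) ge.
  by rewrite !big.
have pos nu i : padded_defined n nu -> (nth 0%N nu i == 0%N) = (size nu <= i).
  case/andP=> /andP[_ l0] _; have [lt|ge] := ltnP i (size nu); last by rewrite nth_default.
  by apply: contraNF l0 => /eqP<-; apply: mem_nth.
apply: (@eq_from_nth _ 0%N) => [|i _]; last exact: e.
apply/eqP; rewrite eqn_leq -(pos _ _ lam) e nth_default // eqxx.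
by rewrite -(pos _ _ mum) -e nth_default.
Qed.

Lemma tableau_exists n la : padded_defined n la ->
  exists T : tableau n, is_tableau (padded n la) T.
Proof.
move=> ok; pose D := [set c : 'I_n * 'I_n | c.2 < nth 0%N (padded n la) c.1].
have cardD : #|D| = n.
  rewrite -sum1_card (partition_big (fun c : 'I_n * 'I_n => c.1) xpredT) //=.
  transitivity (\sum_(i < n) nth 0%N (padded n la) i).
    apply: eq_bigr => i _.
    transitivity #|[set (i, widen_ord (nth_padded_le i ok) c)
                    | c in 'I_(nth 0%N (padded n la) i)]|.
      rewrite -sum1_card; apply: eq_bigl => -[j c]; rewrite !inE /=.
      apply/andP/imsetP => [[lt /eqP e]|[d _ [-> ->]]]; last by rewrite /=.
      by subst j; exists (Ordinal lt) => //; congr (_, _); apply: val_inj.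
    rewrite card_imset ?card_ord // => c d [] e; exact: val_inj.
  case: (posnP n) => [n0|n_gt0].
    by move: (padded n la) => l; subst n; rewrite big_ord0.
  have [_ le] := andP ok.
  have le' : sumn la <= n := leq_trans (leq_addr _ _) le.
  transitivity (sumn (padded n la)); last by rewrite /= subnK.
  rewrite sumnE (big_nth 0%N) big_mkord.
  rewrite [RHS](@big_ord_widen _ _ _ _ n (fun i => nth 0%N (padded n la) i)) ?size_padded //.
  rewrite [RHS]big_mkcond /=; apply: eq_bigr => i _; case: ltnP => // ge.
  by rewrite nth_default.
pose T : tableau n := [ffun k => enum_val (cast_ord (esym cardD) k)].
have TD k : T k \in D by rewrite ffunE enum_valP.
exists T; apply/andP; split.
  by apply/injectiveP => k l; rewrite !ffunE => /enum_val_inj/cast_ord_inj.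
apply/forallP => c; apply/eqP; apply/codomP/idP => [[k ->]|cD].
  by have := TD k; rewrite inE.
have cD' : c \in D by rewrite inE.
exists (cast_ord cardD (enum_rank_in cD' c)).
by rewrite ffunE cast_ordK enum_rankK_in.
Qed.

(** * Young symmetrizers and Specht modules *)

Import GRing.Theory.
Local Open Scope ring_scope.

Section YoungMatrices.

Variables (F : fieldType) (n m : nat).
Variable rG : mx_representation F [set: 'S_n] m.
Implicit Types (T S : tableau n).

Definition col_mxsum T : 'M[F]_m :=
  \sum_(s in col_group T) (-1) ^+ s *: rG s.

Definition row_mxsum T : 'M[F]_m := \sum_(s in row_group T) rG s.

Definition young_mx T : 'M[F]_m := col_mxsum T *m row_mxsum T.

Let rGM s t : rG (s * t)%g = rG s *m rG t.
Proof. by rewrite repr_mxM ?inE. Qed.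

Lemma mul_col_mxsum T s : s \in col_group T ->
  rG s *m col_mxsum T = (-1) ^+ s *: col_mxsum T.
Proof.
move=> sT; rewrite mulmx_sumr scaler_sumr (reindex_inj (mulgI s^-1%g)) /=.
apply: eq_big => [t|t tT]; first by rewrite groupMl ?groupV.
by rewrite -scalemxAr -rGM mulKVg odd_permM odd_permV signr_addb scalerA.
Qed.

Lemma col_mxsum_mul T s : s \in col_group T ->
  col_mxsum T *m rG s = (-1) ^+ s *: col_mxsum T.
Proof.
move=> sT; rewrite mulmx_suml scaler_sumr (reindex_inj (mulIg s^-1%g)) /=.
apply: eq_big => [t|t tT]; first by rewrite groupMr ?groupV.
by rewrite -scalemxAl -rGM mulgKV odd_permM odd_permV signr_addb scalerA mulrC.
Qed.

Lemma mul_row_mxsum T s : s \in row_group T -> rG s *m row_mxsum T = row_mxsum T.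
Proof.
move=> sT; rewrite mulmx_sumr (reindex_inj (mulgI s^-1%g)) /=.
apply: eq_big => [t|t tT]; first by rewrite groupMl ?groupV.
by rewrite -rGM mulKVg.
Qed.

Lemma col_mxsum_idem T :
  col_mxsum T *m col_mxsum T = #|col_group T|%:R *: col_mxsum T.
Proof.
rewrite {1}/col_mxsum mulmx_suml.
under eq_bigr => s sT do
  rewrite -scalemxAl mul_col_mxsum // scalerA -signr_addb addbb scale1r.
by rewrite sumr_const scaler_nat.
Qed.

Lemma col_mxsum_conj T S (s : 'S_n) : (forall k, S k = T (s k)) ->
  col_mxsum S = rG s *m col_mxsum T *m rG s^-1%g.
Proof.
move=> ST; rewrite mulmx_sumr mulmx_suml (reindex_inj (conjg_inj s)) /=.
apply: eq_big => [t|t _].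
  rewrite inE [RHS]inE; apply/forallP/forallP => h k; last first.
    by have := h (s k); rewrite !permM permK !ST.
  by have := h (s^-1%g k); rewrite !ST !permM permKV.
rewrite -scalemxAr -scalemxAl -!rGM odd_permJ; congr (_ *: rG _).
by rewrite /conjg mulKVg mulgK.
Qed.

Lemma col_mxsum_module (U : 'M_m) T : mxmodule rG U -> (U *m col_mxsum T <= U)%MS.
Proof.
move/mxmoduleP=> modU; rewrite mulmx_sumr summx_sub // => s _.
by rewrite -scalemxAr scalemx_sub ?modU ?inE.
Qed.

Lemma young_mx_module (U : 'M_m) T : mxmodule rG U -> (U *m young_mx T <= U)%MS.
Proof.
move=> modU; rewrite mulmxA; apply: submx_trans (submxMr _ (col_mxsum_module T modU)) _.
by rewrite mulmx_sumr summx_sub // => s _; rewrite (mxmoduleP modU) ?inE.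
Qed.

Hypothesis F0 : [pchar F] =i pred0.

(** The transposition of x and y fixes v and changes the sign of the
    antisymmetrizer. *)
Lemma col_mxsum_eq0 k (v : 'M_(k, m)) T x y : x != y -> (T x).2 = (T y).2 ->
  v *m rG (tperm x y) = v -> v *m col_mxsum T = 0.
Proof.
move=> xy Txy vxy; apply/eqP; have /pcharf0P two := F0.
have : v *m col_mxsum T = - (v *m col_mxsum T).
  rewrite -[in LHS]vxy -mulmxA mul_col_mxsum; last exact: tperm_fiber_stab.
  by rewrite odd_tperm xy expr1 scaleN1r mulmxN.
move/eqP; rewrite -addr_eq0 -mulr2n -scaler_nat scaler_eq0.
by rewrite two.
Qed.

Lemma col_row_mxsum_eq0 T S x y : x != y -> (T x).2 = (T y).2 ->
  (S x).1 = (S y).1 -> col_mxsum T *m row_mxsum S = 0.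
Proof.
move=> xy Txy Sxy; apply/eqP; have /pcharf0P two := F0.
have : col_mxsum T *m row_mxsum S = - (col_mxsum T *m row_mxsum S).
  rewrite -[in LHS](@mul_row_mxsum _ (tperm x y)); last exact: tperm_fiber_stab.
  rewrite mulmxA col_mxsum_mul; last exact: tperm_fiber_stab.
  by rewrite odd_tperm xy expr1 scaleN1r mulNmx.
move/eqP; rewrite -addr_eq0 -mulr2n -scaler_nat scaler_eq0.
by rewrite two.
Qed.

End YoungMatrices.

Lemma young_mx_submod (F : fieldType) n m (rG : mx_representation F [set: 'S_n] m) (U : 'M_m)
    (modU : mxmodule rG U) T :
  \rank (young_mx (submod_repr modU) T) = \rank (U *m young_mx rG T).
Proof.
rewrite -(eqmxMr _ (val_submod1 U)) -(mxrankMfree _ (row_base_free U)).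
congr (\rank _); rewrite -[LHS]/(val_submod (young_mx (submod_repr modU) T)).
have valM A s : val_submod (A *m submod_repr modU s) = val_submod A *m rG s.
  by rewrite val_submodJ ?inE.
have col A : val_submod (A *m col_mxsum (submod_repr modU) T)
           = val_submod A *m col_mxsum rG T.
  rewrite /col_mxsum !mulmx_sumr linear_sum; apply: eq_bigr => s _ /=.
  by rewrite -!scalemxAr linearZ /= valM.
have row A : val_submod (A *m row_mxsum (submod_repr modU) T)
           = val_submod A *m row_mxsum rG T.
  rewrite /row_mxsum !mulmx_sumr linear_sum; apply: eq_bigr => s _ /=.
  exact: valM.
by rewrite -[young_mx (submod_repr modU) T]mul1mx /young_mx !mulmxA row col.
Qed.

Lemma young_mx_rsim (F : fieldType) n m1 m2 (rG1 : mx_representation F [set: 'S_n] m1)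
    (rG2 : mx_representation F [set: 'S_n] m2) T :
  mx_rsim rG1 rG2 -> \rank (young_mx rG1 T) = \rank (young_mx rG2 T).
Proof.
case=> B em; move: rG2 B; rewrite -em => rG2 B B_free homB.
have col : col_mxsum rG1 T *m B = B *m col_mxsum rG2 T.
  rewrite mulmx_suml mulmx_sumr; apply: eq_bigr => s _.
  by rewrite -scalemxAl -scalemxAr homB ?inE.
have row : row_mxsum rG1 T *m B = B *m row_mxsum rG2 T.
  by rewrite mulmx_suml mulmx_sumr; apply: eq_bigr => s _; rewrite homB ?inE.
rewrite -(mxrankMfree _ B_free) /young_mx -mulmxA row mulmxA col -mulmxA.
by rewrite eqmxMfull // row_full_unit -row_free_unit.
Qed.

Section Specht.

Variables (F : fieldType) (n : nat).
Hypothesis F0 : [pchar F] =i pred0.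
Local Notation M := (tabloid_repr F n).
Implicit Types (T S : tableau n) (r : tabloid n) (nu mu : seq nat).

Let natF0 k : (k%:R == 0 :> F) = (k == 0%N).
Proof. by move/pcharf0P: F0 => ->. Qed.

Lemma tabloid_vecM r s : tabloid_vec F r *m M s = tabloid_vec F (tabloid_act r s).
Proof. by rewrite /tabloid_vec -rowE rowK enum_rankK. Qed.

Lemma polytabloidE T : polytabloid F T = tabloid_vec F (rows T) *m col_mxsum M T.
Proof.
rewrite mulmx_sumr; apply: eq_big => [s|s _]; first by rewrite inE.
by rewrite -scalemxAr tabloid_vecM.
Qed.

Lemma tabloid_vec_col_mxsum_neq0 r T :
  tabloid_vec F r *m col_mxsum M T != 0 -> rows_avoid_cols r T.
Proof.
move=> nz x y rxy Txy; apply/eqP; apply: contraNT nz => xy; apply/eqP.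
apply: (col_mxsum_eq0 F0 xy Txy); rewrite tabloid_vecM; congr (tabloid_vec F _).
by apply/ffunP => k; rewrite ffunE tpermV; case: tpermP => // ->.
Qed.

(** The sizes of the unions of the first rows are what the dominance lemma
    compares; they determine the lengths of the rows. *)
Definition same_rows r T :=
  [forall k : 'I_n.+1, #|[pred x | r x < k]%N| == #|[pred x | (T x).1 < k]%N|].

Lemma same_rowsP r T : reflect
  (forall k, #|[pred x | r x < k]%N| = #|[pred x | (T x).1 < k]%N|) (same_rows r T).
Proof.
apply: (iffP forallP) => h k; last by rewrite h.
have [lt|ge] := ltnP k n.+1; first by have /eqP := h (Ordinal lt).
have /eqP := h ord_max; rewrite /= => e.
rewrite -[LHS](eq_card (A := [pred x | r x < n]%N)); last first.
  by move=> x; rewrite !inE !(leq_trans (ltn_ord _)) // ltnW.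
rewrite e; apply: eq_card => x; rewrite !inE !(leq_trans (ltn_ord _)) // ltnW //.
Qed.

(** This is the permutation module on the tabloids of the shape of T, in which
    the Specht module of that shape lies. *)
Definition shape_mx T := (\sum_(r | same_rows r T) <<tabloid_vec F r>>)%MS.

Lemma tabloid_vec_shape r T : same_rows r T -> (tabloid_vec F r <= shape_mx T)%MS.
Proof. by move=> rT; apply: (sumsmx_sup r); rewrite ?genmxE. Qed.

Lemma same_rows_act r T s : same_rows (tabloid_act r s) T = same_rows r T.
Proof.
apply: eq_forallb => k; congr (_ == _).
rewrite -[RHS](card_imset _ (@perm_inj _ s)); apply: eq_card => x.
rewrite !inE ffunE; apply/idP/imsetP => [xk|[y + ->]].
  by exists (s^-1%g x); rewrite ?inE // permKV.
by rewrite inE permK.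
Qed.

Lemma shape_mx_module T : mxmodule M (shape_mx T).
Proof.
apply/mxmoduleP => s _; rewrite sumsmxMr; apply/sumsmx_subP => r rT.
rewrite (eqmxMr _ (genmxE _)) tabloid_vecM.
by rewrite tabloid_vec_shape ?same_rows_act.
Qed.

Lemma specht_sub_shape nu T : is_tableau nu T ->
  (specht_mx F n nu <= shape_mx T)%MS.
Proof.
move=> nuT; apply/sumsmx_subP => S nuS; apply: cyclic_mx_sub.
  exact: shape_mx_module.
rewrite polytabloidE; apply: submx_trans (col_mxsum_module _ (shape_mx_module T)).
apply/submxMr/tabloid_vec_shape/same_rowsP => k.
rewrite (same_shape_rows k nuT nuS); apply: eq_card => x.
by rewrite !inE ffunE.
Qed.

(** A tabloid of the shape of T that survives the antisymmetrizer is a column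
    permutation of the tabloid of T, so its image is the polytabloid up to
    sign. *)
Lemma shape_col_mxsum nu T : sorted geq nu -> is_tableau nu T ->
  (shape_mx T *m col_mxsum M T <= polytabloid F T)%MS.
Proof.
move=> nu_sorted nuT; rewrite sumsmxMr; apply/sumsmx_subP => r /same_rowsP rT.
rewrite (eqmxMr _ (genmxE _)).
have [->|/tabloid_vec_col_mxsum_neq0 av] := eqVneq (tabloid_vec F r *m col_mxsum M T) 0.
  exact: sub0mx.
have [s sT ->] := rows_avoid_cols_same_shape nu_sorted nuT av rT.
rewrite -tabloid_vecM -mulmxA mul_col_mxsum // -scalemxAr -polytabloidE.
by rewrite scalemx_sub.
Qed.

Lemma polytabloid_specht nu T : is_tableau nu T ->
  (polytabloid F T <= specht_mx F n nu)%MS.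
Proof. by move=> nuT; apply: (sumsmx_sup T) => //; apply: cyclic_mx_id. Qed.

Lemma polytabloid_comp T S (s : 'S_n) : (forall k, S k = T (s k)) ->
  polytabloid F S = polytabloid F T *m M s^-1%g.
Proof.
move=> ST; rewrite !polytabloidE (col_mxsum_conj M ST) !mulmxA tabloid_vecM.
congr (tabloid_vec F _ *m _ *m _); apply/ffunP => k.
by rewrite !ffunE ST permKV.
Qed.

Lemma specht_cyclic nu T (U : 'M_(#|{: tabloid n}|)) : is_tableau nu T ->
  mxmodule M U -> (polytabloid F T <= U)%MS -> (specht_mx F n nu <= U)%MS.
Proof.
move=> nuT modU TU; apply/sumsmx_subP => S nuS; apply: cyclic_mx_sub => //.
have [s /polytabloid_comp->] := tableau_perm nuT nuS.
apply: submx_trans (submxMr _ TU) _; exact: (mxmoduleP modU _ (in_setT _)).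
Qed.

Lemma tabloid_vecE r r' : tabloid_vec F r 0 (enum_rank r') = (r' == r)%:R.
Proof. by rewrite mxE eqxx (inj_eq enum_rank_inj). Qed.

(** Only the identity is both a row and a column permutation, so the
    coefficient of the tabloid of T is the number of row permutations, which
    is not 0 in characteristic 0. *)
Lemma polytabloid_row_mxsum nu T : is_tableau nu T ->
  polytabloid F T *m row_mxsum M T != 0.
Proof.
move=> nuT; apply/eqP => /matrixP/(_ 0 (enum_rank (rows T))); rewrite [RHS]mxE.
have -> : polytabloid F T *m row_mxsum M T =
    \sum_(q in col_group T) \sum_(p in row_group T)
      (-1) ^+ q *: tabloid_vec F (tabloid_act (rows T) (q * p)%g).
  rewrite polytabloidE -mulmxA /col_mxsum mulmx_suml mulmx_sumr.
  apply: eq_bigr => q _; rewrite -scalemxAl -scalemxAr mulmxA tabloid_vecM.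
  rewrite mulmx_sumr scaler_sumr; apply: eq_bigr => p _.
  by rewrite tabloid_vecM tabloid_actM.
rewrite summxE (bigD1 1%g) ?group1 //= [X in _ + X]big1 => [|q /andP[qT q1]]; last first.
  rewrite summxE big1 // => p /fiber_stabP pT; rewrite mxE tabloid_vecE.
  case: eqP => [/ffunP e|]; last by rewrite mulr0.
  case/eqP: q1; apply: (row_col_trivial nuT) => //; rewrite -groupV.
  apply/fiber_stabP => k; have := e ((q * p)%g (q^-1%g k)).
  by rewrite !ffunE permK permM permKV pT => ->.
rewrite addr0 summxE.
rewrite (eq_bigr (fun=> 1)) => [|p pT]; last first.
  rewrite mxE tabloid_vecE odd_perm1 mul1r mul1g; case: eqP => // [[]].
  apply/ffunP => k; rewrite !ffunE; have /fiber_stabP -> // : p^-1%g \in row_group T.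
  by rewrite groupV.
by rewrite sumr_const => /eqP; rewrite natF0 eqn0Ngt cardG_gt0.
Qed.

Lemma polytabloid_neq0 nu T : is_tableau nu T -> polytabloid F T != 0.
Proof. by move/polytabloid_row_mxsum; apply: contraNneq => ->; rewrite mul0mx. Qed.

Lemma polytabloid_col_mxsum T : polytabloid F T *m col_mxsum M T =
  #|col_group T|%:R *: polytabloid F T.
Proof. by rewrite polytabloidE -mulmxA col_mxsum_idem scalemxAr. Qed.

Lemma Maschke m (rG : mx_representation F [set: 'S_n] m) :
  mx_completely_reducible rG 1%:M.
Proof. by apply: mx_Maschke_pchar; rewrite /pgroup pcharf'_nat natF0 -lt0n cardG_gt0. Qed.

Lemma specht_col_mxsum_polytabloid nu T (U : 'M_(#|{: tabloid n}|)) :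
    sorted geq nu -> is_tableau nu T -> mxmodule M U ->
    (U <= specht_mx F n nu)%MS -> U *m col_mxsum M T != 0 ->
  (specht_mx F n nu <= U)%MS.
Proof.
move=> nu_sorted nuT modU US nz; apply: (specht_cyclic nuT modU).
apply: submx_trans (col_mxsum_module T modU).
have sub : (U *m col_mxsum M T <= polytabloid F T)%MS.
  apply: submx_trans (shape_col_mxsum nu_sorted nuT); apply: submxMr.
  exact: submx_trans US (specht_sub_shape nuT).
have := mxrank_leqif_sup sub => -[_ <-].
by rewrite eqn_leq mxrankS // rank_rV (leq_trans (leq_b1 _)) // lt0n mxrank_eq0.
Qed.

(** The polytabloid survives the antisymmetrizer, so a submodule or its
    complement does.  The one that survives contains the polytabloid, which
    generates the Specht module, so it is everything. *)
Lemma specht_simple nu T : sorted geq nu -> is_tableau nu T ->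
  mxsimple M (specht_mx F n nu).
Proof.
move=> nu_sorted nuT; have TS := polytabloid_specht nuT.
split=> [||U modU US nzU]; first exact: specht_mx_module.
  by apply: contraNneq (polytabloid_neq0 nuT) => S0; rewrite -submx0 -S0.
have [U0|nz] := eqVneq (U *m col_mxsum M T) 0; last first.
  exact: specht_col_mxsum_polytabloid nz.
have [W modW defS dxUW] := mx_reducibleS (specht_mx_module F n nu) (submx1 _)
  (@Maschke _ M) modU US.
have WS : (W <= specht_mx F n nu)%MS by rewrite -defS addsmxSr.
have SW : (specht_mx F n nu <= W)%MS.
  apply: (specht_col_mxsum_polytabloid nu_sorted nuT) => //.
  apply: contraNneq (polytabloid_neq0 nuT) => W0.
  have /submx0null/eqP : (polytabloid F T *m col_mxsum M T <= (0 : 'M_(#|{: tabloid n}|)))%MS.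
    apply: submx_trans (submxMr _ TS) _.
    by rewrite -(eqmxMr _ defS) addsmxMr U0 W0 addsmx0.
  by rewrite polytabloid_col_mxsum scaler_eq0 natF0 eqn0Ngt cardG_gt0.
case/eqP: nzU; apply/eqP; rewrite -submx0 -(mxdirect_addsP dxUW) sub_capmx submx_refl.
exact: submx_trans US SW.
Qed.

(** The column part of the symmetrizer of T forces the shape of S to be
    dominated by that of T, and its row part forces the converse. *)
Lemma specht_young_neq0 nu mu T S : sorted geq nu -> sorted geq mu ->
    is_tableau nu T -> is_tableau mu S ->
    specht_mx F n mu *m young_mx M T != 0 -> same_rows (rows S) T.
Proof.
move=> nu_sorted mu_sorted nuT muS nz; apply/same_rowsP => k.
have rowsE (T' : tableau n) : #|[pred x | rows T' x < k]%N| = #|[pred x | (T' x).1 < k]%N|.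
  by apply: eq_card => x; rewrite !inE ffunE.
apply/eqP; rewrite eqn_leq; apply/andP; split.
  have : shape_mx S *m col_mxsum M T != 0.
    apply: contraNneq nz => S0; rewrite mulmxA -submx0.
    apply: submx_trans (submxMr _ (submxMr _ (specht_sub_shape muS))) _.
    by rewrite S0 mul0mx.
  apply: contraNT => lt; rewrite -submx0 sumsmxMr; apply/sumsmx_subP => r /same_rowsP rS.
  rewrite (eqmxMr _ (genmxE _)) submx0; apply: contraNT lt => /tabloid_vec_col_mxsum_neq0.
  by move/(rows_avoid_cols_dominance k nu_sorted nuT); rewrite rS rowsE.
(* The Specht module is stable under the column part, so the row part alone
   does not kill it. *)
have {nz} : specht_mx F n mu *m row_mxsum M T != 0.
  apply: contraNneq nz => S0; rewrite mulmxA -submx0 -S0 submxMr //.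
  exact: col_mxsum_module (specht_mx_module _ _ _).
rewrite rowsE; apply: contraNT => lt; rewrite -submx0 sumsmxMr.
apply/sumsmx_subP => S' muS'.
have BA0 (S2 : tableau n) : is_tableau mu S2 -> col_mxsum M S2 *m row_mxsum M T = 0.
  move=> muS2; apply/eqP; apply: contraNT lt => nz.
  rewrite -(rowsE T) (same_shape_rows k muS muS2).
  apply: (rows_avoid_cols_dominance k mu_sorted muS2) => x y.
  rewrite !ffunE => e1 e2; apply/eqP; apply: contraNT nz => xy.
  by apply/eqP; apply: (col_row_mxsum_eq0 _ F0 xy e2 e1).
apply/row_subP => i; rewrite row_mul; set v := row i _.
have /cyclic_mxP[A /envelop_mxP[a ->] ->] : (v <= cyclic_mx M (polytabloid F S'))%MS.
  exact: row_sub.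
rewrite [polytabloid _ _ *m _]mulmx_sumr mulmx_suml summx_sub // => s _.
rewrite -scalemxAr -scalemxAl scalemx_sub //.
pose S2 : tableau n := [ffun k => S' (s^-1%g k)].
have := @polytabloid_comp S' S2 s^-1%g; rewrite invgK => <- => [|l]; last by rewrite ffunE.
by rewrite polytabloidE -mulmxA BA0 ?mulmx0 ?sub0mx // is_tableau_comp.
Qed.

Lemma rank_specht_young nu T : sorted geq nu -> is_tableau nu T ->
  \rank (specht_mx F n nu *m young_mx M T) = 1%N.
Proof.
move=> nu_sorted nuT; apply/eqP; rewrite eqn_leq; apply/andP; split.
  have : (specht_mx F n nu *m young_mx M T <= polytabloid F T *m row_mxsum M T)%MS.
    rewrite mulmxA submxMr //; apply: submx_trans (shape_col_mxsum nu_sorted nuT).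
    exact/submxMr/specht_sub_shape.
  by move/mxrankS/leq_trans; apply; apply: rank_leq_row.
rewrite lt0n mxrank_eq0; apply: contraNneq (polytabloid_row_mxsum nuT) => S0.
have : (polytabloid F T *m young_mx M T <= (0 : 'M_(#|{: tabloid n}|)))%MS.
  by rewrite -S0 submxMr ?polytabloid_specht.
rewrite mulmxA polytabloid_col_mxsum -scalemxAl submx0 scaler_eq0 natF0.
by rewrite eqn0Ngt cardG_gt0.
Qed.

Lemma specht_irreducible la : padded_defined n la ->
  mx_irreducible (specht F n (padded n la)).
Proof.
move=> ok; have [T nuT] := tableau_exists ok.
by apply/submod_mx_irr/specht_simple/nuT/sorted_padded.
Qed.

Lemma rank_young_specht la mu T : padded_defined n la -> padded_defined n mu ->
    is_tableau (padded n mu) T ->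
  \rank (young_mx (specht F n (padded n la)) T) = (la == mu).
Proof.
move=> ok_la ok_mu muT; rewrite young_mx_submod.
case: eqVneq => [e|]; first by rewrite e rank_specht_young ?sorted_padded.
apply: contraNeq; rewrite mxrank_eq0; have [S laS] := tableau_exists ok_la.
move/(specht_young_neq0 (sorted_padded ok_mu) (sorted_padded ok_la) muT laS).
move/same_rowsP => same; apply/eqP/(padded_inj ok_la ok_mu) => i lt_in.
have rowE (T' : tableau n) : #|[pred x | (T' x).1 < i.+1]%N| =
    (#|[pred x | (T' x).1 < i]%N| + #|[pred x | (T' x).1 == Ordinal lt_in]|)%N.
  rewrite -cardUI [X in (_ + X)%N]eq_card0 ?addn0 => [|x]; last first.
    by rewrite !inE; case: eqP => [->|]; rewrite ?ltnn ?andbF.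
  by apply: eq_card => x; rewrite !inE ltnS leq_eqVlt orbC.
have {}same k : #|[pred x | (S x).1 < k]%N| = #|[pred x | (T x).1 < k]%N|.
  by rewrite -same; apply: eq_card => x; rewrite !inE ffunE.
have := rowE S; rewrite same rowE same => /addnI.
by rewrite (card_row laS) ?(card_row muT) ?nth_padded_le.
Qed.

End Specht.

(** * Decomposition into Specht modules *)

Section Decomposition.

Variables (F : closedFieldType) (n : nat).
Hypothesis F0 : [pchar F] =i pred0.
Local Notation G := [set: 'S_n].
Local Notation padded_index la := (padded_defined n (map val (la : n.-bseq 'I_n.+1))).

Lemma map_val_inj (la mu : n.-bseq 'I_n.+1) : map val la = map val mu -> la = mu.
Proof. by move=> e; apply/val_inj/(inj_map val_inj). Qed.

Lemma specht_rsim_inj la mu : padded_defined n la -> padded_defined n mu ->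
  mx_rsim (specht F n (padded n la)) (specht F n (padded n mu)) -> la = mu.
Proof.
move=> ok_la ok_mu; have [T laT] := tableau_exists ok_la.
move/(young_mx_rsim T); rewrite !(rank_young_specht F0 _ ok_la laT) // eqxx.
by case: eqVneq.
Qed.

(** The Specht modules are pairwise non-isomorphic irreducible
    representations, and there are at least as many of them as conjugacy
    classes, hence as irreducible representations. *)
Lemma irr_specht m (rG : mx_representation F G m) : mx_irreducible rG ->
  exists2 la : n.-bseq 'I_n.+1, padded_index la &
    mx_rsim rG (specht F n (padded n (map val la))).
Proof.
move=> irr; pose sG : irrType F G := DecSocleType (regular_repr F G).
have F'G : ([pchar F]^'.-group G)%g.
  by rewrite /pgroup pcharf'_nat; have /pcharf0P -> := F0; rewrite -lt0n cardG_gt0.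
have splitG : group_splitting_field F G by apply: group_closure_closed_field.
pose g (la : n.-bseq 'I_n.+1) := irr_comp sG (specht F n (padded n (map val la))).
have gP la : padded_index la ->
    mx_rsim (specht F n (padded n (map val la))) (irr_repr (g la)).
  by move=> ok; apply: rsim_irr_comp_pchar => //; apply: specht_irreducible.
have g_inj : {in [pred la | padded_index la] &, injective g}.
  move=> la mu /[!inE] ok_la ok_mu e; apply/map_val_inj/specht_rsim_inj => //.
  apply: mx_rsim_trans (gP _ ok_la) _; rewrite e.
  exact: mx_rsim_sym (gP _ ok_mu).
have im : irr_comp sG rG \in g @: [pred la | padded_index la].
  suff -> : g @: [pred la | padded_index la] = [set: sG] by rewrite inE.
  apply/eqP; rewrite eqEcard subsetT cardsT (card_in_imset g_inj).
  by rewrite (card_irr_pchar sG F'G splitG) card_classes_perm.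
case/imsetP: im => la /[!inE] ok e; exists la => //.
apply: mx_rsim_trans (rsim_irr_comp_pchar sG F'G irr) _; rewrite e.
exact: mx_rsim_sym (gP _ ok).
Qed.

(** The socle of a completely reducible representation is the direct sum of
    its isotypic components; the multiplicity of a shape is read off from the
    component of its type, if there is one. *)
Lemma specht_decomposition m (rG : mx_representation F G m) :
  exists2 c, forall la, ~~ padded_defined n la -> c la = 0%N &
    mx_rsim rG (specht_sum F n c).
Proof.
pose sR := DecSocleType rG.
have [lab labP lab_sim] := fin_all_exists2 (fun W : sR => irr_specht (socle_irr W)).
have lab_inj : injective lab.
  move=> W W' e; apply/eqP/socle_rsimP; apply: mx_rsim_trans (lab_sim W) _.
  by rewrite e; apply/mx_rsim_sym/lab_sim.
pose soc la := [pick W | lab W == la].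
have socK W : soc (lab W) = Some W.
  rewrite /soc; case: pickP => [W' /eqP/lab_inj->//|/(_ W)].
  by rewrite eqxx.
have soc_some la W : soc la = Some W -> la = lab W.
  by rewrite /soc; case: pickP => // W' /eqP<- [->].
pose c l := if padded_defined n l
            then oapp (fun W : sR => socle_mult W) 0%N (soc (padded_bseq n l))
            else 0%N.
exists c => [la|]; first by rewrite /c => /negbTE->.
have bseqK (la : n.-bseq 'I_n.+1) : padded_index la -> padded_bseq n (map val la) = la.
  by move=> ok; apply: map_val_inj; rewrite padded_bseqK.
pose W la := oapp val 0 (soc la) : 'M_m.
pose modW la : mxmodule rG (W la) :=
  if soc la is Some Wi as oWi return mxmodule rG (oapp val 0 oWi) then
    component_mx_module rG (socle_base Wi)
  else mxmodule0 rG m.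
have [defS dxS] : (\sum_(la | padded_index la) W la :=: 1%:M)%MS /\
                  mxdirect (\sum_(la | padded_index la) W la).
  rewrite mxdirectE /= !(bigID (fun la => isSome (soc la)) (fun la => padded_index la)) /=.
  rewrite addsmxC big1 => [|la /andP[_]]; last by rewrite /W; case: (soc la).
  rewrite adds0mx_id addnC (@big1 nat) ?add0n => [|la /andP[_]]; last first.
    by rewrite /W; case: (soc la); rewrite ?mxrank0.
  have <- : Socle sR = 1%:M := reducible_Socle1 sR (@Maschke _ _ F0 _ rG).
  have padS la : padded_index la && soc la = soc la :> bool.
    by case e: (soc la) => [Wi|]; rewrite ?andbF // (soc_some _ _ e) labP.
  rewrite !(eq_bigl _ _ padS).
  have [W0 _|noW] := pickP sR; last first.
    have no_la : (soc : pred _) =1 xpred0.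
      by move=> la; rewrite /soc; case: pickP => // W0; have := noW W0.
    by rewrite /Socle !(big_pred0 _ _ _ _ no_la) !big_pred0 ?mxrank0.
  have bij_lab : {on [pred la | soc la], bijective lab}.
    exists (odflt W0 \o soc) => [Wi _|la]; first by rewrite /= socK.
    by rewrite inE /=; case e: (soc la) => [Wi|] //= _; rewrite (soc_some _ _ e).
  rewrite !(reindex lab) //=.
  have all_soc Wi : soc (lab Wi) = true :> bool by rewrite socK.
  rewrite (eq_bigr val) => [|Wi _]; last by rewrite /W socK.
  rewrite !(eq_bigl _ _ all_soc); split=> //.
  rewrite (eq_bigr (mxrank \o val)) => [|Wi _]; last by rewrite /W socK.
  by rewrite -mxdirectE /= Socle_direct.
apply: mx_rsim_trans (mx_rsim_sym (rsim_submod1 (mxmodule1 rG) _)) _ => //.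
apply: (@mx_rsim_dsum _ _ _ _ rG _ (fun la => padded_index la) W
  (fun la => muln_grepr (specht F n (padded n (map val la))) (c (map val la)))
  _ modW _ defS dxS) => la.
rewrite /c; have [ok|no] := boolP (padded_index la); last first.
  have e : soc la = None.
    by case e: (soc la) no => [Wi|] //; rewrite (soc_some _ _ e) labP.
  move: (modW la); rewrite /W e /= => mod0; rewrite /muln_grepr big_ord0.
  by exists 0 => [||x _]; rewrite /row_free ?mxrank0 ?mulmx0 ?mul0mx.
rewrite bseqK //; rewrite /W /modW; case e: (soc la) => [Wi|] /=; last first.
  rewrite /muln_grepr big_ord0.
  by exists 0 => [||x _]; rewrite /row_free ?mxrank0 ?mulmx0 ?mul0mx.
rewrite (soc_some _ _ e); apply: mx_rsim_socle; exact: lab_sim.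
Qed.

Section RankSum.

Variables (T : tableau n).
Local Notation rk W := (\rank (young_mx (W : representation F G) T)).

Lemma rank_young_dadd (W1 W2 : representation F G) :
  rk (dadd_grepr W1 W2) = (rk W1 + rk W2)%N.
Proof.
rewrite -rank_diag_block_mx; congr (\rank _).
have sumB (P : pred 'S_n) (f : 'S_n -> F) :
    \sum_(s | P s) f s *: block_mx (W1 s) 0 0 (W2 s) =
    block_mx (\sum_(s | P s) f s *: W1 s) 0 0 (\sum_(s | P s) f s *: W2 s).
  elim/big_rec3: _ => [|s A B C _ ->]; first by rewrite block_mx0.
  by rewrite scale_block_mx !scaler0 add_block_mx !addr0.
have colB : col_mxsum (dadd_grepr W1 W2) T
          = block_mx (col_mxsum W1 T) 0 0 (col_mxsum W2 T) by exact: sumB.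
have rowB : row_mxsum (dadd_grepr W1 W2) T
          = block_mx (row_mxsum W1 T) 0 0 (row_mxsum W2 T).
  have one (W : representation F G) : row_mxsum W T = \sum_(s in row_group T) 1 *: W s.
    by apply: eq_bigr => s _; rewrite scale1r.
  by rewrite !one; exact: sumB.
by rewrite /young_mx colB rowB mulmx_block !mulmx0 !mul0mx !addr0 add0r.
Qed.

Lemma rank_young_dsum I r (P : pred I) (W : I -> representation F G) :
  rk (\big[dadd_grepr/grepr0]_(i <- r | P i) W i) = (\sum_(i <- r | P i) rk (W i))%N.
Proof.
apply: (big_morph (fun W : representation F G => rk W) rank_young_dadd).
by apply/eqP; rewrite -leqn0 rank_leq_row.
Qed.

Lemma rank_young_specht_sum la c : padded_defined n la ->
  is_tableau (padded n la) T -> rk (specht_sum F n c) = c la.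
Proof.
move=> ok laT; rewrite rank_young_dsum (bigD1 (padded_bseq n la)) ?padded_bseqK //=.
rewrite big1 ?addn0 => [|mu /andP[ok_mu ne]]; rewrite rank_young_dsum.
  rewrite sum_nat_const card_ord (rank_young_specht F0 (la := la) _ ok laT) ?padded_bseqK //.
  by rewrite eqxx muln1.
rewrite big1 // => k _; rewrite (rank_young_specht F0 ok_mu ok laT).
by case: eqP => // e; rewrite -e in ne; case/eqP: ne; apply: map_val_inj; rewrite padded_bseqK.
Qed.

End RankSum.

End Decomposition.

(** * Diagonal substitutions of polynomials *)

From mathcomp Require Import boolp.

Section Rename.

Variables (F : fieldType).

Definition mpush N M (g : 'I_N -> 'I_M) (m : 'X_{1..N}) : 'X_{1..M} :=
  (\sum_k U_(g k) *+ m k)%MM.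

Definition mpull N M (g : 'I_N -> 'I_M) (m : 'X_{1..M}) : 'X_{1..N} :=
  [multinom m (g k) | k < N].

Variables (N M : nat) (g : 'I_N -> 'I_M).
Implicit Types (m : 'X_{1..N}) (p : {mpoly F[N]}).

Lemma mpush_out m l : (forall k, g k != l) -> mpush g m l = 0%N.
Proof.
move=> out; rewrite mnm_sumE big1 // => k _.
by rewrite mulmnE mnm1E (negbTE (out k)).
Qed.

Lemma mdeg_mpush m : mdeg (mpush g m) = mdeg m.
Proof.
rewrite mdeg_sum [RHS]mdegE; apply: eq_bigr => k _.
by rewrite mdegMn mdeg1 mul1n.
Qed.

Lemma msize_rename p : (msize (rename g p) <= msize p)%N.
Proof.
rewrite {1}[p]mpolyE raddf_sum /= big_seq; elim/big_rec: _ => [|m q mp IH].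
  by rewrite msize0.
apply: leq_trans (msizeD_le _ _) _; rewrite geq_max IH andbT linearZ /=.
apply: leq_trans (msizeZ_le _ _) _.
by rewrite renameX msizeX -/(mpush g m) mdeg_mpush msize_mdeg_lt.
Qed.

Hypothesis g_inj : injective g.

Lemma mpushE m k : mpush g m (g k) = m k.
Proof.
rewrite mnm_sumE (bigD1 k) //= big1 ?addn0 => [|l lk].
  by rewrite mulmnE mnm1E eqxx mul1n.
by rewrite mulmnE mnm1E (inj_eq g_inj) (negbTE lk).
Qed.

Lemma mpushK (m : 'X_{1..M}) : (forall l, (forall k, g k != l) -> m l = 0%N) ->
  mpush g (mpull g m) = m.
Proof.
move=> m0; apply/mnmP => l; have [/codomP[k ->]|out] := boolP (l \in codom g).
  by rewrite mpushE mnmE.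
have {}out k : g k != l by apply: contraNneq out => <-; apply: codom_f.
by rewrite mpush_out ?m0.
Qed.

(** A renaming by an injective map permutes monomials, except that a monomial
    involving a variable outside the image of g does not occur. *)
Lemma mcoeff_rename p (m : 'X_{1..M}) :
  (rename g p)@_m = if [forall l, (l \notin codom g) ==> (m l == 0%N)]
                    then p@_(mpull g m) else 0.
Proof.
have E m' : mpush g m' == m = [forall l, (l \notin codom g) ==> (m l == 0%N)]
                              && (m' == mpull g m).
  apply/eqP/andP => [<-|[/forallP h /eqP->]]; last first.
    apply: mpushK => l out; apply/eqP; apply: (implyP (h l)).
    by apply/codomP => -[k /esym/eqP]; rewrite (negbTE (out k)).
  split; last by apply/eqP/mnmP => k; rewrite mnmE mpushE.
  apply/forallP => l; apply/implyP => out; rewrite mpush_out // => k.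
  by apply: contraNneq out => <-; apply: codom_f.
rewrite {1}[p]mpolyE (linear_sum (rename g)) (raddf_sum (mcoeff m)) /=; under eq_bigr => m' _ do
  rewrite linearZ /= mcoeffZ renameX mcoeffX -/(mpush g m') E.
case: ifP => _; last by rewrite big1 // => m' _; rewrite mulr0.
rewrite [in RHS](mpolyE p) (raddf_sum (mcoeff _)) /=; apply: eq_bigr => m' _.
by rewrite mcoeffZ mcoeffX.
Qed.

End Rename.

Section DiagonalAction.

Variables (F : fieldType).

Definition free_index n (m : 'X_{1..n + n}) (x : 'I_n) :=
  (m (lshift n x) == 0%N) && (m (rshift n x) == 0%N).

Lemma card_not_free n (m : 'X_{1..n + n}) :
  (#|[pred x | ~~ free_index m x]| <= mdeg m)%N.
Proof.
rewrite mdegE big_split_ord /= -big_split /= -sum1_card big_mkcond /=.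
apply: leq_sum => x _; rewrite inE /free_index negb_and.
by case: (m _) (m _) => [|a] [|b].
Qed.

Lemma split_index n (k : 'I_(n + n)) :
  (exists x, k = lshift n x) \/ (exists x, k = rshift n x).
Proof. by case: (split_ordP k) => x ->; [left|right]; exists x. Qed.

Lemma diag_index_out n m (f : 'I_n -> 'I_m) x : (forall y, f y != x) ->
  (forall k, diag_index f k != lshift m x) /\ (forall k, diag_index f k != rshift m x).
Proof.
move=> fx; split=> k; case: (split_index k) => -[y ->];
  by rewrite ?diag_index_lshift ?diag_index_rshift ?eq_lshift ?eq_rshift
     ?eq_lrshift ?eq_rlshift.
Qed.

Lemma diag_substM n (s t : 'S_n) (p : {mpoly F[n + n]}) :
  diag_subst (s * t)%g p = diag_subst t (diag_subst s p).
Proof. by rewrite -diag_subst_comp; apply: eq_diag_subst => k; rewrite permM. Qed.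

Lemma diag_subst1 n (p : {mpoly F[n + n]}) : diag_subst (1%g : 'S_n) p = p.
Proof. by apply: diag_subst_id => k; rewrite perm1. Qed.

Lemma diag_subst_tpermX n (x y : 'I_n) m : free_index m x -> free_index m y ->
  diag_subst (tperm x y) 'X_[F, m] = 'X_[m].
Proof.
case/andP=> /eqP mlx /eqP mrx /andP[/eqP mly /eqP mry].
rewrite /diag_subst renameX; congr 'X_[_]; rewrite -/(mpush _ m).
have t_inj := @diag_index_inj _ _ (tperm x y) (@perm_inj _ _).
have idx k : m (diag_index (tperm x y) k) = m k.
  case: (split_index k) => -[z ->]; rewrite ?diag_index_lshift ?diag_index_rshift;
  by case: tpermP => // ->; rewrite ?mlx ?mly ?mrx ?mry.
apply/mnmP => k; rewrite -{1}[k](_ : diag_index (tperm x y) (diag_index (tperm x y) k) = k).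
  by rewrite mpushE ?idx.
by case: (split_index k) => -[z ->]; rewrite !(diag_index_lshift, diag_index_rshift) tpermK.
Qed.

Lemma mcoeff_diag_subst n m (f : 'I_n -> 'I_m) p u : injective f ->
  (@diag_subst F n m f p)@_(mpush (diag_index f) u) = p@_u.
Proof.
move=> /diag_index_inj f_inj; rewrite /diag_subst mcoeff_rename //.
have -> : [forall l, (l \notin codom (diag_index f)) ==> (mpush (diag_index f) u l == 0%N)].
  apply/forallP => l; apply/implyP => out; rewrite mpush_out // => k.
  by apply: contraNneq out => <-; apply: codom_f.
by congr (_@_ _); apply/mnmP => k; rewrite mnmE mpushE.
Qed.

Lemma diag_subst_inj n m (f : 'I_n -> 'I_m) : injective f ->
  injective (@diag_subst F n m f).
Proof.
move=> f_inj p q e; apply/mpolyP => u.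
by rewrite -(mcoeff_diag_subst p u f_inj) e mcoeff_diag_subst.
Qed.

Section Symmetrizers.

Variable n : nat.
Implicit Types (T : tableau n) (p q : {mpoly F[n + n]}).

Definition col_sum T p := \sum_(s in col_group T) (-1) ^+ s *: diag_subst s p.
Definition row_sum T p := \sum_(s in row_group T) diag_subst s p.

Lemma col_sum_is_linear T : linear (col_sum T).
Proof.
move=> a p q; rewrite /col_sum scaler_sumr -big_split /=; apply: eq_bigr => s _.
by rewrite linearP scalerDr !scalerA mulrC.
Qed.

Lemma row_sum_is_linear T : linear (row_sum T).
Proof.
move=> a p q; rewrite /row_sum scaler_sumr -big_split /=; apply: eq_bigr => s _.
by rewrite linearP.
Qed.

HB.instance Definition _ T :=
  GRing.isLinear.Build F {mpoly F[n + n]} {mpoly F[n + n]} _ (col_sum T)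
    (col_sum_is_linear T).

HB.instance Definition _ T :=
  GRing.isLinear.Build F {mpoly F[n + n]} {mpoly F[n + n]} _ (row_sum T)
    (row_sum_is_linear T).

Section Closed.

Variables (T : tableau n) (S : {pred {mpoly F[n + n]}}).
Hypotheses (S_lin : submod_closed S)
  (S_stable : forall (s : 'S_n) p, p \in S -> diag_subst s p \in S).

Lemma submodZ a p : p \in S -> a *: p \in S.
Proof. by case: S_lin => S0 lin pS; rewrite -[_ *: _]addr0 lin. Qed.

Lemma row_sum_closed p : p \in S -> row_sum T p \in S.
Proof.
case: S_lin => S0 lin pS; rewrite /row_sum; elim/big_rec: _ => // s q _ qS.
by rewrite -[diag_subst _ _]scale1r lin ?S_stable.
Qed.

Lemma col_sum_closed p : p \in S -> col_sum T p \in S.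
Proof.
case: S_lin => S0 lin pS; rewrite /col_sum; elim/big_rec: _ => // s q _ qS.
by rewrite lin ?S_stable.
Qed.

End Closed.

Lemma row_sum_subst T s p : s \in row_group T ->
  row_sum T (diag_subst s p) = row_sum T p.
Proof.
move=> sT; rewrite /row_sum [RHS](reindex_inj (mulgI s)) /=.
by apply: eq_big => [t|t _]; rewrite ?groupMl // diag_substM.
Qed.

Lemma subst_row_sum T s p : s \in row_group T ->
  diag_subst s (row_sum T p) = row_sum T p.
Proof.
move=> sT; rewrite /row_sum raddf_sum [RHS](reindex_inj (mulIg s)) /=.
by apply: eq_big => [t|t _]; rewrite ?groupMr // diag_substM.
Qed.

Lemma col_sum_subst T s p : s \in col_group T ->
  col_sum T (diag_subst s p) = (-1) ^+ s *: col_sum T p.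
Proof.
move=> sT; rewrite /col_sum [in RHS](reindex_inj (mulgI s)) scaler_sumr /=.
apply: eq_big => [t|t _]; first by rewrite groupMl.
by rewrite diag_substM odd_permM signr_addb scalerA mulrA -signr_addb addbb mul1r.
Qed.

(** The transposition of x and y fixes the monomial and changes the sign of
    its antisymmetrization. *)
Lemma col_sum_free T m x y : [pchar F] =i pred0 -> x != y ->
    (T x).2 = (T y).2 -> free_index m x -> free_index m y ->
  col_sum T 'X_[m] = 0.
Proof.
move=> F0 xy Txy mx my; apply/eqP.
have /(col_sum_subst 'X_[m]) : tperm x y \in col_group T by apply: tperm_fiber_stab.
rewrite diag_subst_tpermX // odd_tperm xy expr1 scaleN1r => /eqP.
rewrite -addr_eq0 -mulr2n -scaler_nat scaler_eq0.
by have /pcharf0P -> := F0.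
Qed.

Lemma msize_subst m (f : 'I_n -> 'I_m) p : (msize (diag_subst f p) <= msize p)%N.
Proof. exact: msize_rename. Qed.

End Symmetrizers.

End DiagonalAction.

(** * Appending an index to the first row of a tableau *)

Notation lift_last s := (lift_perm ord_max ord_max s).

Lemma fix_last_lift n (s : 'S_n.+1) : s ord_max = ord_max ->
  exists t, s = lift_last t.
Proof.
move=> smax; have ne k : ord_max != s (lift ord_max k).
  by rewrite -{1}smax (inj_eq perm_inj) neq_lift.
pose f k := s2val (unlift_some (ne k)).
have fE k : lift ord_max (f k) = s (lift ord_max k).
  by rewrite /f; case: (unlift_some (ne k)).
have f_inj : injective f.
  by move=> k l e; apply: (@lift_inj _ ord_max); apply: (@perm_inj _ s); rewrite -!fE e.
exists (perm f_inj); apply/permP => k; case: (unliftP ord_max k) => [l ->|->].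
  by rewrite lift_perm_lift permE fE.
by rewrite lift_perm_id smax.
Qed.

Section Extension.

Variables (F : fieldType) (n : nat).
Hypothesis F0 : [pchar F] =i pred0.
Local Notation phi := (@diag_subst F n n.+1 (lift ord_max)).
Implicit Types (T : tableau n) (p : {mpoly F[n + n]}).

(** The last index goes to the column c of the first row; with c the length of
    that row in T, the result is a tableau of the shape with one more cell
    there. *)
Definition extend_tableau T (c : nat) : tableau n.+1 :=
  [ffun k => if unlift ord_max k is Some l
             then (widen_ord (leqnSn n) (T l).1, widen_ord (leqnSn n) (T l).2)
             else (ord0, inord c)].

Lemma extend_lift T c k : extend_tableau T c (lift ord_max k) =
  (widen_ord (leqnSn n) (T k).1, widen_ord (leqnSn n) (T k).2).
Proof. by rewrite ffunE liftK. Qed.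

Lemma extend_last T c : extend_tableau T c ord_max = (ord0, inord c).
Proof. by rewrite ffunE unlift_none. Qed.

Lemma phi_subst (s : 'S_n) p : phi (diag_subst s p) = diag_subst (lift_last s) (phi p).
Proof.
rewrite -!diag_subst_comp; apply: eq_diag_subst => k /=.
by rewrite lift_perm_lift.
Qed.

Lemma widen_inj m k (le : (m <= k)%N) : injective (widen_ord le).
Proof. by move=> x y /(congr1 val) e; apply: val_inj. Qed.

Lemma row_group_lift T c s : (lift_last s \in row_group (extend_tableau T c))
  = (s \in row_group T).
Proof.
apply/fiber_stabP/fiber_stabP => h k.
  by have := h (lift ord_max k); rewrite lift_perm_lift !extend_lift => /widen_inj.
case: (unliftP ord_max k) => [l ->|->]; last by rewrite lift_perm_id.
by rewrite lift_perm_lift !extend_lift /= h.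
Qed.

Lemma col_group_lift T c s : (lift_last s \in col_group (extend_tableau T c))
  = (s \in col_group T).
Proof.
apply/fiber_stabP/fiber_stabP => h k.
  by have := h (lift ord_max k); rewrite lift_perm_lift !extend_lift => /widen_inj.
case: (unliftP ord_max k) => [l ->|->]; last by rewrite lift_perm_id.
by rewrite lift_perm_lift !extend_lift /= h.
Qed.

Lemma row_sum_phi T c p : row_sum (extend_tableau T c) (phi (row_sum T p)) =
  #|row_group T|%:R *: row_sum (extend_tableau T c) (phi p).
Proof.
rewrite {2}/row_sum (raddf_sum phi) (raddf_sum (row_sum _)) /=.
rewrite (eq_bigr (fun=> row_sum (extend_tableau T c) (phi p))) => [|s sT].
  by rewrite sumr_const scaler_nat.
by rewrite phi_subst row_sum_subst // row_group_lift.
Qed.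

Section NewColumn.

Variables (T : tableau n) (c : nat).
Hypotheses (c_le : (c <= n)%N) (c_new : forall k, (T k).2 != c :> nat).
Local Notation T1 := (extend_tableau T c).

(** The last index is alone in its column, so the column permutations fix
    it. *)
Lemma col_group_extend : col_group T1 = [set lift_last s | s in col_group T].
Proof.
apply/setP => s; apply/idP/imsetP => [sT|[t + ->]]; last by rewrite col_group_lift.
have /fix_last_lift[t st] : s ord_max = ord_max.
  have /fiber_stabP/(_ ord_max) := sT; rewrite extend_last /=.
  case: (unliftP ord_max (s ord_max)) => [k ->|-> //].
  rewrite extend_lift /= => /(congr1 val) /= e.
  by have := c_new k; rewrite e inordK ?eqxx.
by exists t; rewrite // -(col_group_lift _ c) -st.
Qed.

Lemma lift_last_inj : injective (fun s : 'S_n => lift_last s).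
Proof.
move=> s t e; apply/permP => k; apply: (@lift_inj _ ord_max).
by rewrite -!(lift_perm_lift ord_max ord_max) e.
Qed.

Lemma col_sum_phi p : col_sum T1 (phi p) = phi (col_sum T p).
Proof.
rewrite /col_sum col_group_extend big_imset /=; last by move=> s t _ _ /lift_last_inj.
rewrite (raddf_sum phi) /=; apply: eq_bigr => s _.
by rewrite linearZ /= phi_subst odd_lift_perm addbb.
Qed.

End NewColumn.

Lemma last_out (k : 'I_n) : lift ord_max k != ord_max.
Proof. by rewrite eq_sym neq_lift. Qed.

(** If the coefficient is not 0, the monomial does not involve the image of
    the last index under s; as it does not involve the last index either, s
    may be followed by their transposition.  The resulting permutation fixes
    the last index, hence comes from a row permutation of T, under which p is
    invariant. *)
Lemma mcoeff_phi_row T c s p m :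
    (forall t, t \in row_group T -> diag_subst t p = p) ->
    s \in row_group (extend_tableau T c) ->
  (diag_subst s (phi p))@_(mpush (diag_index (lift ord_max)) m) = p@_m \/
  (diag_subst s (phi p))@_(mpush (diag_index (lift ord_max)) m) = 0.
Proof.
set g := diag_index _ => p_inv sT1.
have g_inj : injective g by apply/diag_index_inj/lift_inj.
set m1 := mpush g m.
have s_inj : injective (diag_index s) by apply/diag_index_inj/perm_inj.
have [outl outr] := diag_index_out (@last_out).
have m1l : m1 (lshift n.+1 ord_max) = 0%N by rewrite /m1 mpush_out.
have m1r : m1 (rshift n.+1 ord_max) = 0%N by rewrite /m1 mpush_out.
rewrite {1 2}/diag_subst mcoeff_rename //.
case: ifP => _; last by right.
rewrite /diag_subst mcoeff_rename //; case: ifP => [/forallP h|_]; [left|by right].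
have s0l : m1 (lshift n.+1 (s ord_max)) = 0%N.
  have /implyP/(_ _)/eqP := h (lshift n.+1 ord_max); rewrite mnmE diag_index_lshift; apply.
  by apply/codomP => -[k /esym/eqP]; rewrite (negbTE (outl k)).
have s0r : m1 (rshift n.+1 (s ord_max)) = 0%N.
  have /implyP/(_ _)/eqP := h (rshift n.+1 ord_max); rewrite mnmE diag_index_rshift; apply.
  by apply/codomP => -[k /esym/eqP]; rewrite (negbTE (outr k)).
have swapT1 : tperm ord_max (s ord_max) \in row_group (extend_tableau T c).
  by apply: tperm_fiber_stab; have /fiber_stabP-> := sT1.
have [|t st] := @fix_last_lift _ (s * tperm ord_max (s ord_max))%g.
  by rewrite permM tpermR.
have tT : t \in row_group T by rewrite -(row_group_lift _ c) -st groupM.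
rewrite -[in RHS](p_inv t tT) /diag_subst mcoeff_rename; last first.
  exact/diag_index_inj/perm_inj.
have -> : [forall l, (l \notin codom (diag_index t)) ==> (m l == 0%N)].
  apply/forallP => l; apply/implyP => /negP[]; apply/codomP.
  exists (diag_index t^-1%g l).
  by case: (split_index l) => -[x ->]; rewrite !(diag_index_lshift, diag_index_rshift) permKV.
congr (_@_ _); apply/mnmP => k; rewrite !mnmE -(mpushE g_inj m) -/m1.
have stE x : lift ord_max (t x) = tperm ord_max (s ord_max) (s (lift ord_max x)).
  by rewrite -permM st lift_perm_lift.
by case: (split_index k) => -[x ->]; rewrite /g !(diag_index_lshift, diag_index_rshift) stE;
  case: tpermP => // ->; rewrite ?m1l ?m1r ?s0l ?s0r.
Qed.

(** For a monomial m of p, each row permutation of the extended tableau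
    contributes to the coefficient of the image of m either 0 or the
    coefficient of m in p, and the identity contributes the latter.  In
    characteristic 0 the total vanishes only if that coefficient does. *)
Lemma row_sum_phi_inj T c p :
    (forall s, s \in row_group T -> diag_subst s p = p) ->
    row_sum (extend_tableau T c) (phi p) = 0 -> p = 0.
Proof.
move=> p_inv rp0; apply/mpolyP => m; rewrite mcoeff0; apply/eqP.
pose m1 := mpush (diag_index (lift ord_max)) m.
pose R1 := row_group (extend_tableau T c).
have : \sum_(s in R1) (diag_subst s (phi p))@_m1 = 0.
  by rewrite -(raddf_sum (mcoeff m1)) /= -/(row_sum _ _) rp0 mcoeff0.

rewrite (bigID (fun s : 'S_n.+1 => (diag_subst s (phi p))@_m1 != 0)) /=.
rewrite [X in _ + X]big1 ?addr0; last first.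
  by move=> s /andP[_ /negbNE/eqP].
rewrite (eq_bigr (fun=> p@_m)) => [|s /andP[sT nz]]; last first.
  by case: (mcoeff_phi_row m p_inv sT) nz => ->; rewrite ?eqxx.
rewrite sumr_const -mulr_natl => /eqP; rewrite mulf_eq0.
have /pcharf0P -> := F0; case/orP=> [/eqP/card0_eq none|//].
have /negbT := none 1%g.
rewrite -[X in ~~ X]/((1%g \in R1) && ((diag_subst (1%g : 'S_n.+1) (phi p))@_m1 != 0)).
rewrite group1 /= negbK.
by rewrite diag_subst1 mcoeff_diag_subst //; apply: lift_inj.
Qed.

End Extension.

(** * Monomials of a given bidegree and tableaux of a padded shape *)

Section PaddedTableaux.

Variables (n : nat) (la : seq nat) (T : tableau n).
Hypotheses (ok : padded_defined n la) (laT : is_tableau (padded n la) T).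
Local Open Scope nat_scope.

Lemma nth_partition_le (nu : seq nat) i : sorted geq nu -> nth 0 nu i <= nth 0 nu 0.
Proof.
move=> srt; have [lt|ge] := ltnP i (size nu); last by rewrite nth_default.
have := @sorted_leq_nth _ geq _ _ 0 nu srt; apply=> //.
- by move=> a b c ba cb; apply: leq_trans cb ba.
- by move=> a; apply: leqnn.
- by rewrite inE (leq_ltn_trans _ lt).
Qed.

Lemma col_bound k : (T k).2 < n - sumn la.
Proof.
have [_ T_cell] := is_tableauP laT.
have : T k \in codom T by rewrite codom_f.
rewrite T_cell => /leq_trans; apply.
exact: nth_partition_le (sorted_padded ok).
Qed.

Lemma row0_of_col k : head 0 la <= (T k).2 -> (T k).1 = 0 :> nat.
Proof.
have [_ T_cell] := is_tableauP laT => ge.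
have : T k \in codom T by rewrite codom_f.
rewrite T_cell; case: (nat_of_ord (T k).1) => //= i; rewrite ltnNge => /negP[].
have /andP[/andP[srt _] _] := ok.
by apply: leq_trans ge; rewrite -nth0; apply: nth_partition_le.
Qed.

Lemma col_singleton x y : head 0 la <= (T x).2 -> (T x).2 = (T y).2 -> x = y.
Proof.
move=> ge e; have [T_inj _] := is_tableauP laT; apply: T_inj.
rewrite [LHS]surjective_pairing [RHS]surjective_pairing e; congr (_, _).
by apply: val_inj; rewrite /= !row0_of_col -?e.
Qed.

Lemma extend_is_tableau :
  is_tableau (padded n.+1 la) (extend_tableau T (n - sumn la)).
Proof.
have [T_inj T_cell] := is_tableauP laT.
have le : sumn la <= n by have /andP[_] := ok; apply: leq_trans; apply: leq_addr.
have c_lt : n - sumn la < n.+1 by rewrite ltnS leq_subr.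
apply/andP; split.
  apply/injectiveP => k l; case: (unliftP ord_max k) => [x ->|->];
    case: (unliftP ord_max l) => [y ->|->] //; rewrite ?extend_lift ?extend_last.
  - move=> [e1 e2]; congr (lift _ _); apply: T_inj.
    by rewrite [LHS]surjective_pairing [RHS]surjective_pairing; congr (_, _); apply: val_inj.
  - move/(congr1 (fun c => val c.2)); rewrite /= inordK // => e.
    by have := col_bound x; rewrite e ltnn.
  - move/(congr1 (fun c => val c.2)); rewrite /= inordK // => e.
    by have := col_bound y; rewrite -e ltnn.
have grow i : nth 0 (padded n la) i <= nth 0 (padded n.+1 la) i.
  by case: i => //=; rewrite leq_sub2r.
apply/forallP => -[i c]; apply/eqP; apply/codomP/idP => [[k]|].
  case: (unliftP ord_max k) => [x ->|->]; rewrite ?extend_lift ?extend_last => -[-> ->] /=.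
    have : T x \in codom T by rewrite codom_f.
    by rewrite T_cell => /leq_trans; apply.
  by rewrite inordK // subSn.
have cellP (i' c' : nat) : c' < nth 0 (padded n la) i' ->
    exists x, (T x).1 = i' :> nat /\ (T x).2 = c' :> nat.
  move=> lt; have n_gt0 : 0 < n.
    by apply: leq_trans (nth_padded_le i' ok); apply: leq_ltn_trans lt.
  have i'n : i' < n.
    rewrite ltnNge; apply: contraL lt => ge; rewrite nth_default //.
    exact: leq_trans (size_padded ok n_gt0) ge.
  have c'n : c' < n by apply: leq_trans lt (nth_padded_le i' ok).
  have : (Ordinal i'n, Ordinal c'n) \in codom T by rewrite T_cell.
  by case/codomP=> x e; exists x; rewrite -e.
have use (x : 'I_n) : (T x).1 = i :> nat -> (T x).2 = c :> nat ->
    exists k, (i, c) = extend_tableau T (n - sumn la) k.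
  move=> e1 e2; exists (lift ord_max x); rewrite extend_lift.
  by congr (_, _); apply: val_inj.
have [lt _|ge lt] := ltnP c (nth 0 (padded n la) i).
  by have [x [e1 e2]] := cellP _ _ lt; apply: use e1 e2.
exists ord_max; rewrite extend_last; case: (unliftP ord0 i) lt ge => [j ->|->] /=.
  by move=> h1 h2; have := leq_trans h1 h2; rewrite ltnn.
rewrite subSn // ltnS => le1 le2; congr (_, _); apply: val_inj => /=.
by rewrite inordK //; apply/eqP; rewrite eqn_leq le1 le2.
Qed.

End PaddedTableaux.

Lemma head_le_sumn (la : seq nat) : (head 0 la <= sumn la)%N.
Proof. by case: la => //= a l; apply: leq_addr. Qed.

Lemma padded_defined_small d n la : is_partition la -> (sumn la <= d)%N ->
  (2 * d <= n)%N -> padded_defined n la.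
Proof.
move=> la_part lad dn; rewrite /padded_defined la_part (leq_trans _ dn) //.
by rewrite mul2n -addnn leq_add // (leq_trans (head_le_sumn la)).
Qed.

Section Weight.

Variables (F : fieldType) (i j : nat).
Hypothesis F0 : [pchar F] =i pred0.
Local Notation d := (i + j)%N.

Definition bidegree n (m : 'X_{1..n + n}) :=
  (\sum_(k < n) m (lshift n k) == i)%N && (\sum_(k < n) m (rshift n k) == j)%N.

Lemma mdeg_bidegree n (m : 'X_{1..n + n}) : bidegree m -> mdeg m = d.
Proof. by case/andP=> /eqP<- /eqP<-; rewrite mdegE big_split_ord. Qed.

Lemma bihomogX n (m : 'X_{1..n + n}) :
  ('X_[F, m] \in bihomog (n := n) i j) = bidegree m.
Proof. by rewrite unfold_in /bihomog msuppX /= andbT. Qed.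

Lemma msize_bihomog n (p : {mpoly F[n + n]}) :
  p \in bihomog i j -> (msize p <= d.+1)%N.
Proof.
rewrite unfold_in => /allP pij; rewrite msizeE; apply/bigmax_leqP_seq => m mp _.
by rewrite ltnS (mdeg_bidegree (pij m mp)).
Qed.

Lemma card_free n (m : 'X_{1..n + n}) : (mdeg m <= d)%N ->
  (n - d <= #|[pred x | free_index m x]|)%N.
Proof.
move=> md; rewrite leq_subLR -{1}(card_ord n) -(cardC [pred x | free_index m x]).
rewrite addnC leq_add2r; apply: leq_trans md; apply: leq_trans (card_not_free m).
by apply: subset_leq_card; apply/subsetP => x; rewrite !inE.
Qed.

Lemma bihomog_ind n (P : {mpoly F[n + n]} -> Prop) :
    P 0 -> (forall a p q, P p -> P q -> P (a *: p + q)) ->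
    (forall m, bidegree m -> P 'X_[m]) ->
  forall p, p \in bihomog i j -> P p.
Proof.
move=> P0 Plin PX p; rewrite unfold_in => /allP pij; rewrite [p]mpolyE big_seq.
elim/big_rec: _ => // m q mp Pq; apply: Plin => //; apply: PX; exact: pij.
Qed.

(** By the pigeonhole principle, two absent indices share a column. *)
Lemma col_sum_few_columns n (T : tableau n) (m : 'X_{1..n + n}) w :
    (forall x, free_index m x -> (T x).2 < w)%N ->
    (w < #|[pred x | free_index m x]|)%N ->
  col_sum T 'X_[F, m] = 0.
Proof.
move=> cols; apply: contraTeq => nz; rewrite -leqNgt.
have inj : {in [pred x | free_index m x] &, injective (fun x => (T x).2)}.
  move=> x y /[!inE] mx my Txy; apply/eqP; apply: contraNT nz => xy.
  by apply/eqP; apply: (col_sum_free F0 xy Txy).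
rewrite -(card_in_imset inj).
have [wn|nw] := leqP w n; last first.
  by apply: leq_trans (max_card _) _; rewrite card_ord ltnW.
rewrite -[X in (_ <= X)%N](card_ord w) -(card_imset _ (@widen_inj _ _ wn)).
apply/subset_leq_card/subsetP => _ /imsetP[x /[!inE] mx ->].
by apply/imsetP; exists (Ordinal (cols x mx)) => //; apply: val_inj.
Qed.

(** The tableau has n - |la| columns, and at least n - d indices are absent
    from a monomial of degree d. *)
Lemma col_sum_weight n la (T : tableau n) (p : {mpoly F[n + n]}) :
    padded_defined n la -> is_tableau (padded n la) T -> (d < sumn la)%N ->
    p \in bihomog i j ->
  col_sum T p = 0.
Proof.
move=> ok laT lt; move: p; apply: bihomog_ind => [|a p q p0 q0|m mij].
- by rewrite linear0.
- by rewrite linearP /= p0 q0 scaler0 addr0.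
apply: (@col_sum_few_columns _ _ _ (n - sumn la)) => [x _|]; first exact: col_bound laT _.
have md : (mdeg m <= d)%N by rewrite (mdeg_bidegree mij).
apply: leq_trans (card_free md); apply: ltn_sub2l => //; apply: leq_trans lt _.
by have /andP[_] := ok; apply: leq_trans; apply: leq_addr.
Qed.

(** For a monomial, either some absent index x lies beyond the first la_1
    columns, where the columns have length one, or all the absent indices lie
    in these la_1 <= d columns; as there are at least n + 1 - d > d of them,
    two then share a column and the monomial is killed.  In the first case the
    transposition of x with the last index commutes with all the column
    permutations and is absorbed by the row symmetrizer, so it may be assumed
    that the last index is absent. *)
Lemma young_sum_phi_surj n la (T : tableau n) (p : {mpoly F[n.+1 + n.+1]}) :
    let T1 := extend_tableau T (n - sumn la) in
    padded_defined n la -> is_tableau (padded n la) T ->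
    (sumn la <= d)%N -> (2 * d <= n)%N -> p \in bihomog i j ->
  exists2 q : {mpoly F[n + n]}, q \in bihomog i j &
    row_sum T1 (col_sum T1 p) =
    row_sum T1 (col_sum T1 (diag_subst (lift ord_max) q)).
Proof.
move=> T1 ok laT lad dn; set phi := diag_subst _.
have sub k := bihomog_submod_closed F k i j.
move: p; apply: bihomog_ind => [|a p q [p' p'ij ep] [q' q'ij eq]|m mij].
- by exists 0; [case: (sub n) | rewrite /phi !linear0].
- exists (a *: p' + q'); last by rewrite /phi !linearP /= ep eq.
  by have [_ lin] := sub n; apply: lin.
have md : (mdeg m <= d)%N by rewrite (mdeg_bidegree mij).
have ok1 : padded_defined n.+1 la.
  by have /andP[a b] := ok; rewrite /padded_defined a (leq_trans b).
have laT1 : is_tableau (padded n.+1 la) T1 by apply: extend_is_tableau.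
have [/existsP[x /andP[mx hx]]|none] :=
    boolP [exists x, free_index m x && (head 0%N la <= (T1 x).2)%N]; last first.
  exists 0; [by case: (sub n) | rewrite /phi !linear0].
  suff -> : col_sum T1 'X_[F, m] = 0 by rewrite linear0.
  apply: (@col_sum_few_columns _ T1 m (head 0%N la)) => [x mx|].
    by rewrite ltnNge; apply: contraNN none => ge; apply/existsP; exists x; rewrite mx.
  apply: leq_trans (card_free md); rewrite ltn_subRL.
  apply: leq_ltn_trans (_ : 2 * d < _)%N => //; rewrite mul2n -addnn leq_add2l.
  exact: leq_trans (head_le_sumn la) lad.
have max_col : (head 0%N la <= (T1 ord_max).2)%N.
  rewrite extend_last /= inordK ?ltnS ?leq_subr //.
  by have /andP[_ b] := ok; rewrite leq_subRL ?(leq_trans (leq_addr _ _) b).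
pose t : 'S_n.+1 := tperm x ord_max.
have t_row : t \in row_group T1.
  apply: tperm_fiber_stab; apply: val_inj => /=.
  by rewrite !(row0_of_col ok1 laT1).
have fix_col s y : s \in col_group T1 -> (head 0%N la <= (T1 y).2)%N -> s y = y.
  move=> /fiber_stabP sT1 hy; apply/esym/(col_singleton ok1 laT1 hy).
  by rewrite sT1.
have comm q : col_sum T1 (diag_subst t q) = diag_subst t (col_sum T1 q).
  rewrite /col_sum (raddf_sum (diag_subst t)) /=; apply: eq_bigr => s sT1.
  rewrite linearZ /= -!diag_substM; congr (_ *: diag_subst (fun_of_perm _) _).
  by rewrite [LHS]conjgC /t tpermJ !fix_col.
have t_inj : injective (diag_index t) by apply/diag_index_inj/perm_inj.
pose m1 := mpush (diag_index t) m.
have m1_last : m1 (lshift n.+1 ord_max) = 0%N /\ m1 (rshift n.+1 ord_max) = 0%N.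
  have lE : lshift n.+1 ord_max = diag_index t (lshift n.+1 x).
    by rewrite diag_index_lshift tpermL.
  have rE : rshift n.+1 ord_max = diag_index t (rshift n.+1 x).
    by rewrite diag_index_rshift tpermL.
  by have /andP[/eqP ml /eqP mr] := mx; rewrite lE rE /m1 !mpushE.
have m1K : mpush (diag_index (lift ord_max)) (mpull (diag_index (lift ord_max)) m1) = m1.
  apply: mpushK => [|l out]; first exact/diag_index_inj/lift_inj.
  case: (split_index l) out => -[y ->] out; case: (unliftP ord_max y) out => [z ->|->] out;
    rewrite ?m1_last.1 ?m1_last.2 //.
  - by have := out (lshift n z); rewrite diag_index_lshift eqxx.
  - by have := out (rshift n z); rewrite diag_index_rshift eqxx.
exists 'X_[mpull (diag_index (lift ord_max)) m1].
  have : bidegree m1.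
    rewrite -bihomogX.
    have -> : 'X_[m1] = diag_subst t 'X_[F, m] by rewrite /diag_subst renameX.
    by rewrite bihomog_diag_subst // bihomogX.
  have widenE k : widen_ord (leqnSn n) k = lift ord_max k.
    by apply: val_inj; rewrite /= /bump leqNgt ltn_ord.
  rewrite bihomogX /bidegree !big_ord_recr /= m1_last.1 m1_last.2 !addn0.
  congr (_ && _); congr (_ == _); apply: eq_bigr => k _;
    by rewrite mnmE ?diag_index_lshift ?diag_index_rshift -widenE.
rewrite /phi /diag_subst renameX -/(mpush _ _) m1K.
have -> : 'X_[m1] = diag_subst t 'X_[F, m] by rewrite /diag_subst renameX.
by rewrite comm row_sum_subst.
Qed.

End Weight.

(** * Diagonal harmonics in coordinates *)

(** Take a matrix of maximal rank among those with rows in U: no vector of U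
    can enlarge its row space. *)
Lemma subspace_mx (F : fieldType) m (U : 'rV[F]_m -> Prop) :
    U 0 -> (forall a u v, U u -> U v -> U (a *: u + v)) ->
  exists A : 'M_m, forall v, U v <-> (v <= A)%MS.
Proof.
move=> U0 Ulin.
have Urow k (A : 'M_(k, m)) : (forall i, U (row i A)) -> forall v, (v <= A)%MS -> U v.
  move=> UA v /submxP[w ->]; rewrite mulmx_sum_row.
  elim/big_rec: _ => // i u _ Uu; exact: Ulin.
pose P k := `[< exists2 A : 'M_m, forall i, U (row i A) & \rank A = k >].
have P0 : exists k, P k.
  exists 0%N; apply/asboolP; exists 0; last exact: mxrank0.
  by move=> i; rewrite row0.
have Pm k : P k -> (k <= m)%N by case/asboolP=> A _ <-; apply: rank_leq_col.
have [k /asboolP[A UA rA] max_k] := ex_maxnP P0 Pm.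
exists A => v; split=> [Uv|]; last exact: Urow.
have UAv : forall i, U (row i (A + v)%MS).
  move=> i; have /sub_addsmxP[[a b] /= ->] : (row i (A + v)%MS <= A + v)%MS by apply: row_sub.
  rewrite -[_ + _]addrC [b]mx11_scalar mul_scalar_mx.
  by apply: Ulin => //; apply: Urow (submxMl _ _).
have : P (\rank (A + v)%MS) by apply/asboolP; exists (A + v)%MS.
move/max_k; rewrite -rA => le.
have := mxrank_leqif_sup (addsmxSl A v) => -[le' /esym].
rewrite eqn_leq le' le => /(submx_trans _); apply; exact: addsmxSr.
Qed.

Lemma eq_mx_row_mul (F : fieldType) m k (A B : 'M[F]_(m, k)) :
  (forall v : 'rV_m, v *m A = v *m B) -> A = B.
Proof. by move=> AB; apply/row_matrixP => i; rewrite !rowE. Qed.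

Lemma sn_iso_rsim (F : fieldType) n (V : snModule F n) m
    (rG : mx_representation F [set: 'S_n] m) (f : 'rV_m -> V)
    (W : representation F [set: 'S_n]) :
    linear f -> bijective f ->
    (forall v (s : 'S_n), f (v *m rG s) = sn_act V (f v) s) ->
    mx_rsim rG W -> sn_iso V W.
Proof.
move=> f_lin f_bij f_act /mx_rsim_sym.
case: W => k rW [B /= ek B_free homB].
rewrite /sn_iso /=; move: rW B B_free homB; rewrite ek => rW B B_free homB.
have uB : B \in unitmx by rewrite -row_free_unit.
have fB_lin : linear (f \o mulmxr B) by move=> a u v; rewrite /= mulmxDl -scalemxAl f_lin.
pose fB : {linear 'rV_m -> V} := HB.pack (f \o mulmxr B)
  (GRing.isLinear.Build F 'rV_m V _ (f \o mulmxr B) fB_lin).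
exists fB => [|v s] /=.
  apply: bij_comp => //; exists (mulmxr (invmx B)) => v /=; by rewrite ?mulmxK ?mulmxKV.
by rewrite -f_act -!mulmxA homB ?inE.
Qed.

(** The polynomials of degree at most d in coordinates, to which the theory of
    matrix representations applies. *)
Record poly_model (F : fieldType) n d := PolyModel {
  model_dim : nat;
  model_repr : mx_representation F [set: 'S_n] model_dim;
  poly_of : {linear 'rV[F]_model_dim -> {mpoly F[n + n]}};
  coefs : {linear {mpoly F[n + n]} -> 'rV[F]_model_dim};
  poly_ofK : cancel poly_of coefs;
  coefsK : forall p, (msize p <= d.+1)%N -> poly_of (coefs p) = p;
  poly_of_model : forall v s,
    poly_of (v *m model_repr s) = diag_subst (s : 'S_n) (poly_of v)
}.

Section ModelOfCoordinates.

Variables (F : fieldType) (n d m : nat).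
Variables (P : {linear 'rV[F]_m -> {mpoly F[n + n]}}).
Variables (C : {linear {mpoly F[n + n]} -> 'rV[F]_m}).
Hypotheses (PK : cancel P C)
  (CK : forall p, (msize p <= d.+1)%N -> P (C p) = p)
  (P_msize : forall v, (msize (P v) <= d.+1)%N).

Definition coord_mx (s : 'S_n) : 'M[F]_m := lin1_mx (C \o @diag_subst F n n s \o P).

Lemma coord_mxE v s : P (v *m coord_mx s) = diag_subst s (P v).
Proof.
rewrite mul_rV_lin1 /= CK //; exact: leq_trans (msize_subst _ _) (P_msize v).
Qed.

Lemma coord_mx_repr : mx_repr [set: 'S_n] coord_mx.
Proof.
split=> [|s t _ _]; apply: eq_mx_row_mul => v; apply: (can_inj PK).
  by rewrite coord_mxE diag_subst1 mulmx1.
rewrite mulmxA; apply: etrans (coord_mxE v _) _; apply: esym.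
apply: etrans (coord_mxE _ t) _; apply: etrans (congr1 _ (coord_mxE v s)) _.
exact/esym/diag_substM.
Qed.

Definition model_of_coordinates : poly_model F n d :=
  @PolyModel F n d m (MxRepresentation coord_mx_repr) P C PK CK coord_mxE.

End ModelOfCoordinates.

Section ModelExists.

Variables (F : fieldType) (n d : nat).
Local Notation B := (bmultinom (n + n) d.+1).
Local Notation V := ('rV[F]_#|{: B}|).

Let P (v : V) : {mpoly F[n + n]} :=
  \sum_(k < #|{: B}|) v 0 k *: 'X_[enum_val k : B].

Let C (p : {mpoly F[n + n]}) : V := \row_k p@_(enum_val k : B).

Let P_is_linear : linear P.
Proof.
move=> a u v; rewrite /P scaler_sumr -big_split /=; apply: eq_bigr => k _.
by rewrite !mxE scalerDl scalerA.
Qed.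

HB.instance Definition _ :=
  GRing.isLinear.Build F V {mpoly F[n + n]} _ P P_is_linear.

Let C_is_linear : linear C.
Proof. by move=> a p q; apply/rowP => k; rewrite !mxE linearP. Qed.

HB.instance Definition _ :=
  GRing.isLinear.Build F {mpoly F[n + n]} V _ C C_is_linear.

Let PK : cancel P C.
Proof.
move=> v; apply/rowP => k; rewrite mxE /P (raddf_sum (mcoeff _)) /=.
rewrite (bigD1 k) //= mcoeffZ mcoeffX eqxx mulr1 big1 ?addr0 // => l lk.
by rewrite mcoeffZ mcoeffX -bmeqP (inj_eq enum_val_inj) (negbTE lk) mulr0.
Qed.

Let CK p : (msize p <= d.+1)%N -> P (C p) = p.
Proof.
move=> pd; rewrite [RHS](mpolywE pd) /P.
rewrite [RHS](reindex (fun k : 'I_#|{: B}| => enum_val k : B)) /=; last first.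
  by apply: onW_bij; apply: enum_val_bij.
by apply: eq_bigr => k _; rewrite mxE.
Qed.

Let msizeP v : (msize (P v) <= d.+1)%N.
Proof.
rewrite /P; elim/big_rec: _ => [|k p _ pd]; first by rewrite msize0.
apply: leq_trans (msizeD_le _ _) _; rewrite geq_max pd andbT.
by apply: leq_trans (msizeZ_le _ _) _; rewrite msizeX ltnS -ltnS bmdeg.
Qed.

Lemma standard_model : poly_model F n d.
Proof. exact: (@model_of_coordinates F n d _ P C PK CK msizeP). Qed.

End ModelExists.

Section ModelSums.

Variables (F : fieldType) (n d : nat) (M : poly_model F n d).
Local Notation rho := (model_repr M).

Lemma poly_of_inj (u v : 'rV_(model_dim M)) : poly_of M u = poly_of M v -> u = v.
Proof. by move/(congr1 (coefs M)); rewrite !poly_ofK. Qed.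

Lemma poly_of_col_mxsum T v :
  poly_of M (v *m col_mxsum rho T) = col_sum T (poly_of M v).
Proof.
rewrite /col_mxsum mulmx_sumr (raddf_sum (poly_of M)) /=; apply: eq_bigr => s _.
by rewrite -scalemxAr linearZ /= poly_of_model.
Qed.

Lemma poly_of_row_mxsum T v :
  poly_of M (v *m row_mxsum rho T) = row_sum T (poly_of M v).
Proof.
rewrite /row_mxsum mulmx_sumr (raddf_sum (poly_of M)) /=; apply: eq_bigr => s _.
by rewrite poly_of_model.
Qed.

Lemma poly_of_young_mx T v :
  poly_of M (v *m young_mx rho T) = row_sum T (col_sum T (poly_of M v)).
Proof. by rewrite /young_mx mulmxA poly_of_row_mxsum poly_of_col_mxsum. Qed.

End ModelSums.

(** If v is the image of p and p is decomposed along A and a complementary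
    submodule, the image of the second component is both in A and in the
    complement. *)
Lemma sub_young_mx (F : fieldType) n m (rG : mx_representation F [set: 'S_n] m)
    (A : 'M_m) T (v : 'rV_m) : [pchar F] =i pred0 -> mxmodule rG A ->
  (v <= young_mx rG T)%MS -> (v <= A)%MS -> (v <= A *m young_mx rG T)%MS.
Proof.
move=> F0 modA /submxP[p pv] vA.
have [W modW defW dxAW] := @Maschke _ _ F0 _ rG A modA (submx1 _).
have /sub_addsmxP[[a w] /= pE] : (p <= A + W)%MS by rewrite defW submx1.
suff w0 : w *m W *m young_mx rG T = 0.
  by rewrite pv pE mulmxDl w0 addr0 -mulmxA submxMl.
apply/eqP; rewrite -submx0 -(mxdirect_addsP dxAW) sub_capmx; apply/andP; split.
  have -> : w *m W *m young_mx rG T = v - a *m A *m young_mx rG T.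
    by rewrite pv pE mulmxDl addrC addKr.
  rewrite addmx_sub // eqmx_opp; apply: submx_trans (young_mx_module T modA).
  by rewrite -mulmxA submxMl.
by apply: submx_trans (young_mx_module T modW); rewrite -mulmxA submxMl.
Qed.

Section Stability.

Variables (F : closedFieldType) (i j : nat).
Hypothesis F0 : [pchar F] =i pred0.
Local Notation d := (i + j)%N.
Local Notation M n := (standard_model F n d).
Local Notation rho n := (model_repr (M n)).
Local Notation phi n := (@diag_subst F n n.+1 (lift ord_max)).
Local Notation isDH n := (@bigraded_DH F n i j).

Definition models_DH n (A : 'M[F]_(model_dim (M n))) :=
  forall v, (poly_of (M n) v \in isDH n) = (v <= A)%MS.

Lemma models_DH_exists n : exists A, @models_DH n A.
Proof.
have [D0 Dlin] := bigraded_DH_submod_closed F n i j.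
pose U (v : 'rV[F]_(model_dim (M n))) : Prop := poly_of (M n) v \in isDH n.
have [||A AE] := @subspace_mx F _ U.
- by rewrite /U linear0.
- by move=> a u v Du Dv; rewrite /U linearP; apply: Dlin.
by exists A => v; apply/idP/idP => /AE.
Qed.

Lemma coefs_DH n p : p \in isDH n -> poly_of (M n) (coefs (M n) p) = p.
Proof. by case/andP=> _ /msize_bihomog pd; rewrite coefsK. Qed.

Lemma models_DH_module n A : @models_DH n A -> mxmodule (rho n) A.
Proof.
move=> AE; apply/mxmoduleP => s _; apply/row_subP => k; rewrite row_mul.
rewrite -AE poly_of_model bigraded_DH_diag_subst ?AE ?row_sub //.
exact: perm_inj.
Qed.

Lemma DH_subst_closed n (s : 'S_n) p : p \in isDH n -> diag_subst s p \in isDH n.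
Proof. exact/bigraded_DH_diag_subst/perm_inj. Qed.

Lemma DH_row_sum n (T : tableau n) p : p \in isDH n -> row_sum T p \in isDH n.
Proof.
exact: (row_sum_closed T (bigraded_DH_submod_closed F n i j) (@DH_subst_closed n)).
Qed.

Lemma DH_phi n p : p \in isDH n -> phi n p \in isDH n.+1.
Proof. by apply: bigraded_DH_diag_subst; apply: lift_inj. Qed.

Section OneStep.

Variables (n : nat) (la : seq nat) (T : tableau n).
Hypotheses (dn : (2 * d <= n)%N) (lad : (sumn la <= d)%N).
Hypotheses (ok : padded_defined n la) (laT : is_tableau (padded n la) T).
Local Notation T1 := (extend_tableau T (n - sumn la)).

Let c_new k : (T k).2 != (n - sumn la)%N :> nat.
Proof. by rewrite ltn_eqF // col_bound. Qed.

Let row_neq0 : #|row_group T|%:R != 0 :> F.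
Proof. by have /pcharf0P -> := F0; rewrite -lt0n cardG_gt0. Qed.

(** The surjectivity for polynomials provides v.  An operator that defines the
    harmonics sends v to a polynomial invariant under the row permutations of
    T, which is sent to 0 by the stable map because p is harmonic, hence is
    0. *)
Lemma DH_young_surj p : p \in isDH n.+1 ->
  exists v, [/\ v \in isDH n, exists2 q, q \in bihomog i j & v = row_sum T (col_sum T q)
    & row_sum T1 (col_sum T1 p) = row_sum T1 (phi n v)].
Proof.
move=> pD; have /andP[_ pij] := pD.
have [q qij pq] := young_sum_phi_surj F0 ok laT lad dn pij.
(* The row permutations of T are absorbed by the row symmetrizer of T1. *)
pose a := (#|row_group T|%:R)^-1 : F.
exists (row_sum T (col_sum T (a *: q))).
have eE : row_sum T1 (phi n (row_sum T (col_sum T (a *: q)))) =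
          row_sum T1 (col_sum T1 p).
  rewrite row_sum_phi -(col_sum_phi (leq_subr _ _) c_new) !linearZ /= scalerA.
  by rewrite (mulVf row_neq0) scale1r; exact: esym pq.
have lin := bihomog_submod_closed F n i j.
have stable (s : 'S_n) (r : {mpoly F[n + n]}) :
    r \in bihomog i j -> diag_subst s r \in bihomog i j.
  exact: bihomog_diag_subst.
have aqij : a *: q \in bihomog i j by exact: submodZ.
split; [|by exists (a *: q)|exact: esym eE].
apply/andP; split; last first.
  exact: (row_sum_closed T lin stable (col_sum_closed T lin stable aqij)).
apply/diag_harmonicP => a' b' ab.
have Dphi x : polarized_power_sum_diff a' b' (phi n x) =
    phi n (polarized_power_sum_diff a' b' x).
  exact: polarized_power_sum_diff_subst (@lift_inj _ _) ab.
have Dperm k (s : 'S_k) (x : {mpoly F[k + k]}) :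
    polarized_power_sum_diff a' b' (diag_subst s x) =
    diag_subst s (polarized_power_sum_diff a' b' x).
  exact: polarized_power_sum_diff_subst (@perm_inj _ _) ab.
have Drow k (S : tableau k) (x : {mpoly F[k + k]}) :
    polarized_power_sum_diff a' b' (row_sum S x) =
    row_sum S (polarized_power_sum_diff a' b' x).
  by rewrite /row_sum (raddf_sum (polarized_power_sum_diff a' b')) /=; apply: eq_bigr => s _.
apply: (row_sum_phi_inj F0 (T := T) (c := n - sumn la)) => [s sT|].
  by rewrite -Dperm subst_row_sum.
have Dcol k (S : tableau k) (x : {mpoly F[k + k]}) :
    polarized_power_sum_diff a' b' (col_sum S x) =
    col_sum S (polarized_power_sum_diff a' b' x).
  rewrite /col_sum (raddf_sum (polarized_power_sum_diff a' b')) /=; apply: eq_bigr => s _.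
  by rewrite linearZ /= Dperm.
have /andP[/diag_harmonicP pH _] := pD.
by rewrite -Dphi -Drow eE Drow Dcol (pH _ _ ab) !linear0.
Qed.

(** The map Psi of the proof carries the image of the symmetrizer of T on the
    harmonics bijectively onto that of the symmetrizer of T1. *)
Lemma rank_DH_stable A A1 : @models_DH n A -> @models_DH n.+1 A1 ->
  \rank (A *m young_mx (rho n) T) = \rank (A1 *m young_mx (rho n.+1) T1).
Proof.
move=> AE A1E.
pose Psi := lin1_mx (coefs (M n.+1) \o row_sum T1 \o phi n \o poly_of (M n)).
have PsiE v : (v <= A)%MS -> poly_of (M n.+1) (v *m Psi) = row_sum T1 (phi n (poly_of (M n) v)).
  rewrite -AE => vA; rewrite mul_rV_lin1 /= coefs_DH //.
  exact/DH_row_sum/DH_phi.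
have modA := models_DH_module AE.
have YA : (A *m young_mx (rho n) T <= A)%MS by exact: young_mx_module.
have inj : \rank (A *m young_mx (rho n) T *m Psi) = \rank (A *m young_mx (rho n) T).
  apply/mxrank_injP/rowV0P => v; rewrite sub_capmx => /andP[vY /sub_kermxP vPsi].
  apply: poly_of_inj; rewrite linear0.
  apply: (row_sum_phi_inj F0 (T := T) (c := n - sumn la)) => [s sT|].
    have /submxP[q ->] := vY; rewrite !mulmxA poly_of_row_mxsum.
    exact: subst_row_sum.
  by rewrite -PsiE ?vPsi ?linear0 // (submx_trans vY).
rewrite -inj; apply/eqP; rewrite eqn_leq; apply/andP; split; apply: mxrankS.
  apply/row_subP => k; rewrite -mulmxA row_mul; set q := row k A.
  have qD : poly_of (M n) q \in isDH n by rewrite AE row_sub.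
  have /submxP[u uE] : (coefs (M n.+1) (phi n (poly_of (M n) q)) <= A1)%MS.
    by rewrite -A1E coefs_DH DH_phi.
  suff -> : q *m (young_mx (rho n) T *m Psi) =
      #|row_group T|%:R *: (coefs (M n.+1) (phi n (poly_of (M n) q)) *m young_mx (rho n.+1) T1).
    by rewrite scalemx_sub // uE -mulmxA submxMl.
  apply: poly_of_inj; rewrite mulmxA PsiE; last first.
    by apply: submx_trans YA; rewrite submxMr // row_sub.
  rewrite linearZ /= !poly_of_young_mx coefs_DH ?DH_phi //.
  by rewrite row_sum_phi (col_sum_phi (leq_subr _ _) c_new).
apply/row_subP => k; rewrite row_mul; set p := row k A1.
have pD : poly_of (M n.+1) p \in isDH n.+1 by rewrite A1E row_sub.
have [v [vD [q qij vq] pv]] := DH_young_surj pD.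
have vY : (coefs (M n) v <= A *m young_mx (rho n) T)%MS.
  apply: (sub_young_mx F0 modA); last by rewrite -AE coefs_DH.
  apply/submxP; exists (coefs (M n) q); apply: poly_of_inj.
  rewrite poly_of_young_mx (coefs_DH vD) (coefsK _ (msize_bihomog qij)).
  exact: vq.
suff -> : p *m young_mx (rho n.+1) T1 = coefs (M n) v *m Psi by rewrite submxMr.
apply: poly_of_inj; rewrite poly_of_young_mx pv PsiE ?coefs_DH //.
exact: submx_trans vY YA.
Qed.

End OneStep.

End Stability.

(** * Uniform stability of the diagonal harmonics *)

From mathcomp Require Import classical_sets reals complex.

Section Conclusion.

Variables (F : closedFieldType) (i j : nat).
Hypothesis F0 : [pchar F] =i pred0.
Local Notation d := (i + j)%N.
Local Notation M n := (standard_model F n d).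
Local Notation rho n := (model_repr (M n)).
Local Notation isDH n := (@bigraded_DH F n i j).

Section OneDegree.

Variables (n : nat) (A : 'M[F]_(model_dim (M n))).
Hypothesis AE : models_DH A.
Local Notation rA := (submod_repr (models_DH_module AE)).

Lemma poly_of_submod_DH (v : 'rV_(\rank A)) : poly_of (M n) (val_submod v) \in isDH n.
Proof. by rewrite AE val_submodP. Qed.

Definition DH_of_row (v : 'rV_(\rank A)) : DH_module F n i j :=
  DHComp (poly_of_submod_DH v).

Lemma DH_of_row_is_linear : linear DH_of_row.
Proof. by move=> a u v; apply: val_inj; rewrite /= !linearP. Qed.

Lemma DH_of_row_bij : bijective DH_of_row.
Proof.
exists (fun x : DH F n i j => in_submod A (coefs (M n) (DH_val x))) => [v|x].
  by rewrite /= poly_ofK val_submodK.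
apply: val_inj => /=; rewrite in_submodK ?coefs_DH ?DH_valP //.
by rewrite -AE coefs_DH DH_valP.
Qed.

Lemma DH_specht_iso c : mx_rsim rA (specht_sum F n c) ->
  sn_iso (DH_module F n i j) (specht_sum F n c).
Proof.
apply: (sn_iso_rsim DH_of_row_is_linear DH_of_row_bij) => v s; apply: val_inj => /=.
by rewrite (val_submodJ (models_DH_module AE)) ?inE // poly_of_model.
Qed.

Lemma DH_young_weight la (T : tableau n) : padded_defined n la ->
  is_tableau (padded n la) T -> (d < sumn la)%N ->
  A *m young_mx (rho n) T = 0.
Proof.
move=> ok laT lt; apply/row_matrixP => k; rewrite row_mul row0.
apply: poly_of_inj; rewrite poly_of_young_mx linear0.
have /andP[_ bi] : poly_of (M n) (row k A) \in isDH n by rewrite AE row_sub.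
by rewrite (col_sum_weight F0 ok laT lt bi) linear0.
Qed.

(** Otherwise some Specht module would occur in Z, on which its Young
    symmetrizer does not vanish. *)
Lemma young_mx_detects (Z : 'M[F]_(model_dim (M n))) :
    mxmodule (rho n) Z ->
    (forall la, padded_defined n la -> exists2 T, is_tableau (padded n la) T &
       Z *m young_mx (rho n) T = 0) -> Z = 0.
Proof.
move=> modZ Z0; have [c c0 simZ] := specht_decomposition F0 (submod_repr modZ).
have {}c0 la : c la = 0%N.
  have [ok|/c0//] := boolP (padded_defined n la); have [T laT ZT] := Z0 _ ok.
  by rewrite -(rank_young_specht_sum F0 c ok laT) -(young_mx_rsim T simZ)
    young_mx_submod ZT mxrank0.
apply/eqP; rewrite -mxrank_eq0 (mxrank_rsim simZ) /specht_sum.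
elim/big_rec: _ => // la W _ W0; rewrite c0 /muln_grepr big_ord0 /= W0 //.
Qed.

End OneDegree.

Lemma DH_decomposition n : exists c (A : 'M[F]_(model_dim (M n))),
  [/\ models_DH A, forall la, ~~ padded_defined n la -> c la = 0%N,
      sn_iso (DH_module F n i j) (specht_sum F n c) &
      forall la T, padded_defined n la -> is_tableau (padded n la) T ->
        c la = \rank (A *m young_mx (rho n) T)].
Proof.
have [A AE] := models_DH_exists F i j n.
have [c c0 simA] := specht_decomposition F0 (submod_repr (models_DH_module AE)).
exists c, A; split=> // [|la T ok laT]; first exact: DH_specht_iso simA.
rewrite -(rank_young_specht_sum F0 c ok laT) -(young_mx_rsim T simA).
by rewrite young_mx_submod.
Qed.

(** The images of the Young symmetrizers lie in the generated submodule, so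
    all the symmetrizers vanish on a complement of it. *)
Lemma DH_generated n : (2 * d <= n)%N ->
  smallest (@is_submodule F n.+1 (DH_module F n.+1 i j))
    (range (DH_incl F i j n)) = classical_sets.setT.
Proof.
move=> dn; apply/seteqP; split=> // x0 _ U [[U0 Ulin Uact] rngU].
have [A AE] := models_DH_exists F i j n.+1.
have modA := models_DH_module AE.
(* A is the whole module in coordinates, and Z the submodule U. *)
pose P (v : 'rV[F]_(model_dim (M n.+1))) : Prop :=
  exists2 x : DH F n.+1 i j, U x & poly_of (M n.+1) v = DH_val x.
have [||Z ZE] := @subspace_mx F _ P.
- by exists 0; rewrite ?linear0.
- move=> a u v [x Ux xE] [y Uy yE]; exists (a *: x + y); first exact: Ulin.
  by rewrite linearP xE yE.
have ZA : (Z <= A)%MS.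
  apply/row_subP => k; have /ZE[x Ux xE] : (row k Z <= Z)%MS by apply: row_sub.
  by rewrite -AE xE DH_valP.
have modZ : mxmodule (rho n.+1) Z.
  apply/mxmoduleP => s _; apply/row_subP => k; rewrite row_mul.
  have /ZE[x Ux xE] : (row k Z <= Z)%MS by apply: row_sub.
  apply/ZE; exists (DH_act x s); first exact: Uact.
  by rewrite poly_of_model xE.
have AYZ la : padded_defined n.+1 la -> exists2 T, is_tableau (padded n.+1 la) T &
    (A *m young_mx (rho n.+1) T <= Z)%MS.
  move=> ok1; have [lad|dla] := leqP (sumn la) d; last first.
    have [T laT] := tableau_exists ok1; exists T => //.
    by rewrite (DH_young_weight AE ok1 laT dla) sub0mx.
  have /andP[la_part _] := ok1; have ok := padded_defined_small la_part lad dn.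
  have [T laT] := tableau_exists ok.
  exists (extend_tableau T (n - sumn la)); first exact: extend_is_tableau.
  apply/row_subP => k; rewrite row_mul; apply/ZE.
  have pD : poly_of (M n.+1) (row k A) \in isDH n.+1 by rewrite AE row_sub.
  have [v [vD _ pv]] := DH_young_surj F0 dn lad ok laT pD.
  pose y : DH F n.+1 i j := DH_incl F i j n (DHComp vD).
  exists (\sum_(s in row_group (extend_tableau T (n - sumn la))) DH_act y s).
    elim/big_rec: _ => // s x _ Ux; rewrite -[DH_act _ _]scale1r; apply: Ulin => //.
    by apply: Uact; apply: rngU; exists (DHComp vD).
  rewrite poly_of_young_mx pv /row_sum.
  by rewrite -[RHS]/(\val (\sum_(s in row_group _) DH_act y s)) raddf_sum.
have [W modW defA dxZW] := mx_reducibleS modA (submx1 _) (@Maschke _ _ F0 _ _) modZ ZA.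
have W0 : W = 0.
  apply: (young_mx_detects modW) => la ok; have [T laT AT] := AYZ la ok; exists T => //.
  apply/eqP; rewrite -submx0 -(mxdirect_addsP dxZW) sub_capmx; apply/andP; split.
    by apply: submx_trans AT; rewrite submxMr // -defA addsmxSr.
  exact: young_mx_module.
have : (coefs (M n.+1) (DH_val x0) <= Z)%MS.
  have : (coefs (M n.+1) (DH_val x0) <= A)%MS by rewrite -AE coefs_DH DH_valP.
  by rewrite -defA W0 addsmx0.
case/ZE=> x Ux; rewrite coefs_DH ?DH_valP // => e.
by have -> : x0 = x by apply: val_inj.
Qed.

Lemma DH_URS :
  @URS F (fun n => DH_module F n i j) (DH_incl F i j) (2 * (i + j))%N.
Proof.
split.
- move=> n v s; apply: val_inj => /=; rewrite -!diag_subst_comp.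
  by apply: eq_diag_subst => k /=; rewrite lift_perm_lift.
- move=> n v; apply: val_inj => /=; rewrite -!diag_subst_comp.
  apply: eq_diag_subst => k /=; rewrite /last_transposition tpermD ?neq_lift //.
  apply/eqP => /(congr1 (@nat_of_ord _)); rewrite !lift_max inordK ?ltnS ?leqnSn // => e.
  by have := ltn_ord k; rewrite -e ltnn.
have [c cP] := choice (fun n => DH_decomposition n).
exists c; split=> [n la|n|n dn].
- by have [A [_ c0 _ _]] := cP n; apply: c0.
- by have [A []] := cP n.
have [A [AE c0 _ cE]] := cP n; have [A1 [A1E c10 _ c1E]] := cP n.+1.
split=> [la||]; last exact: DH_generated.
- (* No la with |la| > d occurs, whether or not la[m] is defined. *)
  have weight m (B : 'M[F]_(model_dim (M m))) (e : seq nat -> nat) :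
      models_DH B -> (forall la, ~~ padded_defined m la -> e la = 0%N) ->
      (forall la T, padded_defined m la -> is_tableau (padded m la) T ->
        e la = \rank (B *m young_mx (rho m) T)) -> (d < sumn la)%N -> e la = 0%N.
    move=> BE e0 eE dla; have [ok|/e0//] := boolP (padded_defined m la).
    have [T laT] := tableau_exists ok.
    by rewrite (eE _ _ ok laT) (DH_young_weight BE ok laT dla) mxrank0.
  have [lad|dla] := leqP (sumn la) d; last first.
    exact: etrans (weight _ _ _ AE c0 cE dla) (esym (weight _ _ _ A1E c10 c1E dla)).
  have [part|npart] := boolP (is_partition la); last first.
    have no m : ~~ padded_defined m la by rewrite /padded_defined (negbTE npart).
    exact: etrans (c0 _ (no n)) (esym (c10 _ (no n.+1))).
  have ok := padded_defined_small part lad dn.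
  have ok1 := padded_defined_small part lad (leqW dn).
  have [T laT] := tableau_exists ok.
  rewrite (cE _ _ ok laT) (c1E _ _ ok1 (extend_is_tableau ok laT)).
  exact: (rank_DH_stable F0 dn lad ok laT AE A1E).
- move=> x y /(congr1 (fun z : DH F n.+1 i j => DH_val z)) /= e; apply: val_inj.
  exact: diag_subst_inj (@lift_inj _ ord_max) _ _ e.
Qed.

End Conclusion.

Theorem corollary4p3p1 (R : realType) (i j : nat) :
  @URS R[i] (fun n => DH_module R[i] n i j) (DH_incl R[i] i j) (2 * (i + j))%N.
Proof. exact: (@DH_URS R[i] i j (Num.Theory.pchar_num _)). Qed.
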